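(* There is no Polish semigroup topology on the group of divisors $\mathcal{D}$. There is no Polish semigroup topology on the group $\mathcal{MR}^\times$.
   Context: $\mathcal{D}$ is the abelian group, under pointwise addition, of all maps $d:\mathbb{C}\to\mathbb{Z}$ whose support $\{z:d(z)\neq0\}$ is a closed discrete subset of $\mathbb{C}$. $\mathcal{MR}^\times$ is the multiplicative group of meromorphic functions on $\mathbb{C}$ that do not vanish identically. A topology on a group is a semigroup topology if the group multiplication is (jointly) continuous; no continuity of the inverse map is assumed. A Polish topology is a separable completely metrizable one. *)

(* Defs.v *)
From HB Require Import structures.
From mathcomp Require Import all_boot all_order all_algebra.
From mathcomp Require Import all_classical all_reals all_analysis.
From mathcomp Require Import complex.
Import numFieldNormedType.Exports.

Set Implicit Arguments.
Unset Strict Implicit.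
Unset Printing Implicit Defensive.

Import Order.TTheory GRing.Theory Num.Theory.

Local Open Scope classical_set_scope.
Local Open Scope quotient_scope.
Local Open Scope ring_scope.

Section polish_semigroup_topology.
Variable R : realType.

Definition separable (T : topologicalType) : Prop :=
  exists2 S : set T, countable S & dense S.

Definition homeomorphic (S T : topologicalType) : Prop :=
  exists (f : S -> T) (g : T -> S),
    [/\ cancel f g, cancel g f, continuous f & continuous g].

(* The library's completeType is restricted to pointed types, hence the
   explicit condition on Cauchy filters. *)
Definition complete_metric (M : metricType R) : Prop :=
  forall F : set_system M, ProperFilter F -> cauchy F ->
    exists l : M, F --> l.

Definition completely_metrizable (T : topologicalType) : Prop :=
  exists2 M : metricType R, complete_metric M & homeomorphic T M.

Definition polish (T : topologicalType) : Prop :=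
  separable T /\ completely_metrizable T.

(* The quantified Topological.axioms_ G is the HB class of topological
   structures on the fixed carrier G. *)
Definition has_polish_semigroup_topology (G : Type) (op : G -> G -> G) : Prop :=
  exists tau : Topological.axioms_ G,
    let T : topologicalType := Topological.Pack tau in
    polish T /\ continuous (fun p : T * T => op p.1 p.2 : T).

End polish_semigroup_topology.

Definition Cplx (R : realType) : numClosedFieldType := R[i]%C.

Definition closed_discrete (T : topologicalType) (A : set T) : Prop :=
  closed A /\ A `<=` isolated A.

Section closed_discrete_theory.
Variable T : topologicalType.
Implicit Types A B : set T.

Lemma closed_discreteP A :
  closed_discrete A <-> forall x, \forall z \near x^', ~ A z.
Proof.
split=> [[clA dA] x|nA].
  have [Ax|nAx] := pselect (A x); last first.
    have : nbhs x (~` A) by apply: open_nbhs_nbhs; split=> //; exact: closed_openC.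
    by apply: (@filterS _ (nbhs x)) => z nAz _.
  have [_ [V Vx VA]] := dA _ Ax.
  apply: (@filterS _ (nbhs x) _ V) => // z Vz zx Az.
  have : (V `&` A) z by [].
  by rewrite VA => /= zx'; rewrite zx' eqxx in zx.
have nA' x : nbhs x [set z | z != x -> ~ A z] := nA x.
split.
  rewrite -[A]setCK; apply: open_closedC; rewrite openE => x /= nAx.
  apply: filterS (nA' x) => z /= zA.
  by have [->|/zA] := eqVneq z x.
move=> x Ax; split; first exact/mem_set.
exists [set z | z != x -> ~ A z] => //.
apply/seteqP; split=> [z [/= zx Az]|z /= ->].
  by apply/eqP; apply: contrapT => /negP/zx.
by split=> //=; rewrite eqxx.
Qed.

Lemma closed_discrete0 : closed_discrete (@set0 T).
Proof. by apply/closed_discreteP => x; near=> z. Unshelve. all: by end_near. Qed.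

Lemma sub_closed_discrete A B :
  A `<=` B -> closed_discrete B -> closed_discrete A.
Proof.
move=> AB /closed_discreteP dB; apply/closed_discreteP => x.
by apply: filterS (dB x) => z nB /AB.
Qed.

Lemma closed_discreteU A B :
  closed_discrete A -> closed_discrete B -> closed_discrete (A `|` B).
Proof.
move=> /closed_discreteP dA /closed_discreteP dB; apply/closed_discreteP => x.
by apply: filterS2 (dA x) (dB x) => z nA nB [].
Qed.

End closed_discrete_theory.

Section divisors.
Variable R : realType.

Definition divisor_pred : {pred Cplx R -> int} :=
  [pred d | `[< closed_discrete [set z | d z != 0] >]].

Fact divisor_zmod_closed : zmod_closed divisor_pred.
Proof.
split=> [|d1 d2]; first by apply/asboolP;
  apply: sub_closed_discrete (@closed_discrete0 (Cplx R)) => z /= /eqP; exact.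
move=> /asboolP c1 /asboolP c2; apply/asboolP.
apply: sub_closed_discrete (closed_discreteU c1 c2) => z /=.
have [d1z|] := eqVneq (d1 z) 0; last by left.
have [d2z|] := eqVneq (d2 z) 0; last by right.
have -> : (d1 - d2) z = d1 z - d2 z by [].
by rewrite d1z d2z subrr eqxx.
Qed.
HB.instance Definition _ :=
  GRing.isZmodClosed.Build (Cplx R -> int) divisor_pred divisor_zmod_closed.

Record divisor := Divisor {
  divisor_fun :> Cplx R -> int;
  _ : divisor_fun \in divisor_pred }.

HB.instance Definition _ := [isSub for divisor_fun].
HB.instance Definition _ := [Choice of divisor by <:].
HB.instance Definition _ := [SubChoice_isSubZmodule of divisor by <:].

End divisors.

Section meromorphic.
Variable R : realType.
Notation C := (Cplx R).

Definition holomorphic_at (g : C -> C) (a : C) : Prop :=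
  \forall z \near a, derivable g z 1.

(* At every point, f has at worst a pole; the values of f at its poles and
   removable singularities are irrelevant, see mero below. *)
Definition meromorphic (f : C -> C) : Prop :=
  forall a : C, exists n : nat, exists2 g : C -> C,
    holomorphic_at g a & \forall z \near a^', f z = (z - a) ^- n * g z.

Let derivable_subXn (a z : C) n : derivable (fun y : C => (y - a) ^+ n : C) z 1.
Proof.
have d : derivable (fun y : C => y - a : C) z 1.
  by apply: derivableB; [exact: derivable_id|exact: derivable_cst].
have -> : (fun y : C => (y - a) ^+ n) = (fun y : C => y - a) ^+ n.
  by apply/funext => y; rewrite exprfctE.
exact: derivableX.
Qed.

Let holomorphic_atM (g h : C -> C) a : holomorphic_at g a ->
  holomorphic_at h a -> holomorphic_at (fun z => g z * h z) a.
Proof.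
by apply: filterS2 => z dg dh; exact: (derivableM dg dh).
Qed.

Let holomorphic_atB (g h : C -> C) a : holomorphic_at g a ->
  holomorphic_at h a -> holomorphic_at (fun z => g z - h z) a.
Proof.
by apply: filterS2 => z dg dh; exact: (derivableB dg dh).
Qed.

Let holomorphic_at_subXn (a : C) n : holomorphic_at (fun z : C => (z - a) ^+ n) a.
Proof. by apply: (@filterE _ (nbhs a)) => z; exact: derivable_subXn. Qed.

Definition meromorphic_pred : {pred C -> C} := [pred f | `[< meromorphic f >]].

Fact meromorphic_subring_closed : subring_closed meromorphic_pred.
Proof.
split.
- apply/asboolP => a; exists 0, (cst 1).
    by near=> z; exact: derivable_cst.
  by near=> z; rewrite expr0 invr1 mul1r.
- move=> f1 f2 /asboolP m1 /asboolP m2; apply/asboolP => a.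
  have [n1 [g1 h1 e1]] := m1 a; have [n2 [g2 h2 e2]] := m2 a.
  exists (n1 + n2)%N,
    (fun z => (z - a) ^+ n2 * g1 z - (z - a) ^+ n1 * g2 z).
    exact: (holomorphic_atB (holomorphic_atM (@holomorphic_at_subXn a n2) h1)
      (holomorphic_atM (@holomorphic_at_subXn a n1) h2)).
  near=> z.
  have za : z - a != 0 by rewrite subr_eq0; near: z; exact: nbhs_dnbhs_neq.
  have -> : (f1 - f2) z = f1 z - f2 z by [].
  have -> : f1 z = (z - a) ^- n1 * g1 z by near: z.
  have -> : f2 z = (z - a) ^- n2 * g2 z by near: z.
  rewrite exprD invfM mulrBr !mulrA; congr (_ * _ - _ * _).
    by rewrite mulfVK ?expf_neq0.
  by rewrite mulrAC mulVf ?expf_neq0 ?mul1r.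
- move=> f1 f2 /asboolP m1 /asboolP m2; apply/asboolP => a.
  have [n1 [g1 h1 e1]] := m1 a; have [n2 [g2 h2 e2]] := m2 a.
  exists (n1 + n2)%N, (fun z => g1 z * g2 z).
    exact: (holomorphic_atM h1 h2).
  near=> z.
  have -> : (f1 * f2) z = f1 z * f2 z by [].
  have -> : f1 z = (z - a) ^- n1 * g1 z by near: z.
  have -> : f2 z = (z - a) ^- n2 * g2 z by near: z.
  by rewrite exprD invfM mulrACA.
Unshelve. all: by end_near. Qed.
HB.instance Definition _ :=
  GRing.isSubringClosed.Build (C -> C) meromorphic_pred
    meromorphic_subring_closed.

Record mero_fun := MeroFun {
  mero_fun_val :> C -> C;
  _ : mero_fun_val \in meromorphic_pred }.

HB.instance Definition _ := [isSub for mero_fun_val].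
HB.instance Definition _ := [Choice of mero_fun by <:].
HB.instance Definition _ := [SubChoice_isSubComNzRing of mero_fun by <:].

Definition negligible_pred : {pred mero_fun} :=
  [pred f | `[< closed_discrete [set z | mero_fun_val f z != 0] >]].

Fact negligible_idealr_closed : idealr_closed negligible_pred.
Proof.
split=> [||h f1 f2].
- apply/asboolP; apply: sub_closed_discrete (@closed_discrete0 C) => z /= /eqP.
  exact.
- apply/negP => /asboolP /closed_discreteP /(_ 0) h.
  have [z] : exists z : C, ~ (1 : C) != 0 by apply: (@filter_ex _ (0 : C)^').
  by rewrite oner_neq0.
- move=> /asboolP c1 /asboolP c2; apply/asboolP.
  apply: sub_closed_discrete (closed_discreteU c1 c2) => z /=.
  have [f1z|] := eqVneq (mero_fun_val f1 z) 0; last by left.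
  have [f2z|] := eqVneq (mero_fun_val f2 z) 0; last by right.
  have e : mero_fun_val h z * mero_fun_val f1 z + mero_fun_val f2 z = 0.
    by rewrite f1z f2z mulr0 addr0.
  by case/negP; apply/eqP; exact: e.
Qed.
HB.instance Definition _ :=
  isIdealr.Build mero_fun negligible_pred negligible_idealr_closed.

(* The ring of meromorphic functions: elements of mero_fun up to equality off a
   closed discrete subset of the plane. *)
Definition mero := {ideal_quot negligible_pred}.
HB.instance Definition _ := GRing.ComNzRing.on mero.

Definition mero_nz := {f : mero | f != 0}.

Definition mero_nz1 : mero_nz := exist _ 1 (oner_neq0 mero).

(* By the identity theorem mero is a field, so val f * val g is never 0 and the
   default value mero_nz1 is never used. *)
Definition mero_nz_mul (f g : mero_nz) : mero_nz :=
  insubd mero_nz1 (val f * val g).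

End meromorphic.

(* Main.v *)
Require Import Defs.
From mathcomp Require Import all_boot all_order all_algebra.
From mathcomp Require Import all_classical all_reals all_analysis.
From mathcomp Require Import complex.
From mathcomp Require Import ring lra zify.
Import Order.TTheory GRing.Theory Num.Theory.
Import numFieldNormedType.Exports.

Set Implicit Arguments.
Unset Strict Implicit.
Unset Printing Implicit Defensive.

Local Open Scope classical_set_scope.
Local Open Scope ring_scope.

(** Both groups have a homomorphism to a free abelian group with uncountable
    range: restrict a divisor, or the divisor of zeros and poles of a
    meromorphic function, to the unit square, where its support is finite.
    A homomorphism [phi] from a group with a Polish semigroup topology to a
    free abelian group has countable range ([hom_free_abelian_countable]), so
    no such topology exists.

    The countability is an argument of Dudley. If [phi] were nontrivial on
    every neighbourhood of the identity, one could choose [g n] tending to the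
    identity so fast that, with [k n] large compared with the l1-norm of
    [phi (g n)], the nested words
      [h n = g n * (g n.+1 * (g n.+2 * ...) ^ k n.+1) ^ k n]
    converge by completeness. From [h n = g n * h n.+1 ^ k n] the norms of
    [phi (h n)] are positive and strictly decreasing, which is absurd. Hence
    [phi] is trivial near the identity and locally constant, and a countable
    dense set already takes all its values. The words are made of products
    only, which is why joint continuity of the multiplication suffices.

    Meromorphic functions require the order at a point and the identity
    theorem, starting from bare complex differentiability. Instead of contour
    integrals, the proof uses midpoint sums around a square. They are exactly
    additive when the square is cut into four quarters ([contour_quarter])
    and vanish on affine functions ([contour_affine]), which is all that the
    bisection argument of Goursat needs ([goursat]). Applied to
    [(f z - f w) / (z - w)] it bounds an interior value by the values on the
    boundary ([cauchy_estimate]), and then gives a Lipschitz bound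
    ([cauchy_lipschitz]). Both tolerate finitely many exceptional points near
    which the function is bounded, so they apply to [f z / (z - a) ^+ n].
    Consequently a function bounded and holomorphic near [a], except perhaps
    at [a], either vanishes near [a] or is comparable in modulus to some power
    of the distance to [a] ([bounded_singularity_growth]). The order is
    defined by this comparison ([growth]), which makes it visibly additive. *)


(** * The l1-norm on a free abelian group *)

Section ell1.
Variable I : choiceType.
Implicit Types u v : I -> int.

(** An integer vector of finite support is an element of the free abelian group
    on [I]. *)
Definition ell1 u : nat := (\sum_(i \in [set: I]) `|u i|)%N.

Lemma ell1E u (s : seq I) : uniq s -> (forall i, u i != 0 -> i \in s) ->
  ell1 u = (\sum_(i <- s) `|u i|)%N.
Proof.
move=> us su; rewrite /ell1.
rewrite (fsbigE s) //; last first.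
  by move=> i _; apply: contraNeq; rewrite -lt0n absz_gt0; exact: su.
by apply: eq_bigl => i; rewrite in_setT.
Qed.

Lemma ell1_eq0 u : finite_set [set i | u i != 0] -> ell1 u = 0%N -> u = fun=> 0.
Proof.
move=> /finite_seqP[s0 su]; have us i : u i != 0 -> i \in undup s0.
  by move=> ui; rewrite mem_undup; have : [set i | u i != 0] i by [];
    rewrite su.
rewrite (ell1E (undup_uniq s0) us) => /eqP; rewrite sum_nat_seq_eq0 => /allP h.
apply/funext => i; apply/eqP; apply/negP => /negP ui.
by move: (h _ (us _ ui)); rewrite absz_eq0 (negbTE ui).
Qed.

(** Multiplication by [k] expands the norm by [k], up to the norm of the
    translation: this is what forces the norms in Dudley's argument down. *)
Lemma ell1D_ge u v k : finite_set [set i | u i != 0] ->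
  finite_set [set i | v i != 0] ->
  (k * ell1 v <= ell1 (fun i => u i + v i *+ k)%R + ell1 u)%N.
Proof.
move=> /finite_seqP[s0 su] /finite_seqP[t0 tv]; set s := undup (s0 ++ t0).
have us i : u i != 0 -> i \in s.
  move=> ui; rewrite mem_undup mem_cat; apply/orP; left.
  by have : [set i | u i != 0] i by []; rewrite su.
have vs i : v i != 0 -> i \in s.
  move=> ui; rewrite mem_undup mem_cat; apply/orP; right.
  by have : [set i | v i != 0] i by []; rewrite tv.
have uvs i : u i + v i *+ k != 0 -> i \in s.
  have [ui|/us//] := eqVneq (u i) 0; have [vi|/vs//] := eqVneq (v i) 0.
  by rewrite ui vi mul0rn addr0 eqxx.
have hs := undup_uniq (s0 ++ t0).
rewrite (ell1E hs us) (ell1E hs vs) (ell1E hs uvs) big_distrr -big_split /=.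
apply: leq_sum => i _; rewrite -(absz_nat k) -abszM.
have -> : k%:Z * v i = (u i + v i *+ k) - u i
  by rewrite addrC addKr -mulr_natl natz.
by lia.
Qed.

End ell1.

(** * Homomorphisms from Polish semigroup topologies to free abelian groups *)

Lemma geometric_steps_cvg (R : realType) (M : metricType R) (u : nat -> M) n0 :
  complete_metric M ->
  (forall m, (n0 <= m)%N -> mdist (u m) (u m.+1) < 2^-1 ^+ m) ->
  exists l : M, u m @[m --> \oo] --> l.
Proof.
move=> cM du; apply: cM; apply: cauchy_exP => e e0.
have [m m0] : exists m, 2 * 2^-1 ^+ m < e :> R /\ (n0 <= m)%N.
  have [m _ hm] : \forall m \near \oo, (2^-1 : R) ^+ m < e / 2.
    have /cvgrPdist_lt/(_ (e / 2)) : (2^-1 : R) ^+ m @[m --> \oo] --> (0 : R).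
      by apply: cvg_expr; rewrite gtr0_norm ?invf_lt1 ?ltr1n.
    move=> /(_ ltac:(by rewrite divr_gt0)); apply: filterS => m.
    by rewrite sub0r normrN ger0_norm ?exprn_ge0 ?invr_ge0.
  exists (maxn m n0); rewrite leq_maxr; split => //.
  by have := hm _ (leq_maxl m n0); rewrite ltr_pdivlMr// mulrC.
have bd k : mdist (u m) (u (m + k)%N) <=
  2 * 2^-1 ^+ m - 2 * 2^-1 ^+ (m + k) :> R.
  elim: k => [|k IH]; first by rewrite addn0 mdistxx subrr.
  rewrite addnS; apply: le_trans (metric_triangle _ (u (m + k)%N) _) _.
  have := ltW (du (m + k)%N (leq_trans m0.2 (leq_addr _ _))).
  move: IH; rewrite exprS; set a := mdist _ _; set b := mdist _ _;
    set c := _ ^+ (m + k).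
  by set d := _ ^+ m; lra.
exists (u m), m => // k /= mk; rewrite ballEmdist /=.
apply: le_lt_trans m0.1; rewrite -(subnKC mk); apply: le_trans (bd _) _.
by rewrite gerBl mulr_ge0 ?exprn_ge0 ?invr_ge0.
Qed.

Section automatic_continuity.
Variables (R : realType) (T : topologicalType) (op : T -> T -> T) (e : T).
Variables (inv : T -> T) (I : choiceType) (phi : T -> I -> int).
Hypothesis op1 : left_id e op.
Hypothesis opr1 : right_id e op.
Hypothesis opV : left_inverse e inv op.
Hypothesis opcont : continuous (fun p : T * T => op p.1 p.2).
Hypothesis phiM : forall x y i, phi (op x y) i = phi x i + phi y i.
Hypothesis phifin : forall x, finite_set [set i | phi x i != 0].

Let pow k x := iter k (op x) e.

Let phi1 : phi e = fun=> 0.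
Proof.
apply/funext => i; have := phiM e e i; rewrite op1 => /eqP.
by rewrite -subr_eq0 opprD addrA subrr sub0r oppr_eq0 => /eqP.
Qed.

Let phi_pow k x i : phi (pow k x) i = phi x i *+ k.
Proof.
elim: k => [|k IH]; first by rewrite /pow /= phi1.
by rewrite /pow /= phiM IH mulrS.
Qed.

Let op_cvg (A : Type) (F : set_system A) (f g : A -> T) x y : Filter F ->
  f @ F --> x -> g @ F --> y -> (fun a => op (f a) (g a)) @ F --> op x y.
Proof.
move=> FF fx gy; apply: continuous2_cvg fx gy.
have := @opcont; move/(_ (x, y)); exact.
Qed.

Let pow_cont k : continuous (pow k).
Proof.
move=> x; elim: k => [|k IH]; first exact: cvg_cst.
exact: (@op_cvg _ (nbhs x) id (pow k) x (pow k x) _ (@cvg_id _ _) IH).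
Qed.

(** With this exponent, [ell1D_ge] makes the norm of [phi (step x y)] exceed
    that of [phi y] as soon as the latter is positive. *)
Let mult x := (ell1 (phi x) + 2)%N.
Let step x y := op x (pow (mult x) y).
(** [comp [:: g0; g1; ...; gm] y] is the nested word
    [g0 * (g1 * (... (gm * y ^ km) ...) ^ k1) ^ k0]. *)
Let comp (l : seq T) y := foldr step y l.

Let step_cont x : continuous (step x).
Proof. move=> y; apply: op_cvg; [exact: cvg_cst|exact: pow_cont]. Qed.

Let comp_cont l : continuous (comp l).
Proof.
elim: l => [|x l IH] y; first exact: cvg_id.
exact: (continuous_comp (IH y) (@step_cont x _)).
Qed.

Let pow1 k : pow k e = e.
Proof. by elim: k => // k IH; rewrite /pow /= op1. Qed.

(** If [phi] is nontrivial arbitrarily close to [e], the nested words built on a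
    sufficiently fast sequence tending to [e] converge to limits whose images
    have positive and strictly decreasing norms. *)
Lemma hom_locally_trivial : completely_metrizable R T ->
  \forall x \near e, phi x = fun=> 0.
Proof.
move=> [M cM [f [g [fK gK fc gc]]]]; apply: contrapT => nloc.
(* Given the letters [l] chosen so far, the next letter moves every one of
   the finitely many words on a tail of [l] by little. *)
have next l : exists x, phi x <> (fun=> 0) /\ forall n, (n <= size l)%N ->
    mdist (f (comp (drop n l) e)) (f (comp (drop n l) x)) <
      (2^-1 : R) ^+ size l.
  apply: contrapT => nx; apply: nloc.
  have U : \forall x \near e, forall n : 'I_(size l).+1,
      mdist (f (comp (drop n l) e)) (f (comp (drop n l) x)) <
        (2^-1 : R) ^+ size l.
    apply: filter_forall => n.
    have : (fun x => f (comp (drop n l) x)) x @[x --> e] -->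
      f (comp (drop n l) e).
      by apply: (@continuous_comp _ _ _ (comp (drop n l)) f);
        [exact: comp_cont|exact: fc].
    by move/metricType_numDomainType.cvgrPdist_lt; apply;
      rewrite exprn_gt0 ?invr_gt0.
  apply: filterS U => x hx; apply: contrapT => px; apply: nx; exists x;
    split => // n nl.
  by rewrite -ltnS in nl; exact: (hx (Ordinal nl)).
have [pick pickP] := choice next.
pose pre m := iter m (fun l => rcons l (pick l)) [::].
have size_pre m : size (pre m) = m by elim: m => //= m IH;
  rewrite size_rcons IH.
pose gs m := pick (pre m).
have preS m : pre m.+1 = rcons (pre m) (gs m) by [].
have step_e x : step x e = x by rewrite /step pow1 opr1.
pose P n m := comp (drop n (pre m)) e.
have PS n m : (n <= m)%N -> mdist (f (P n m)) (f (P n m.+1)) < (2^-1 : R) ^+ m.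
  move=> nm; rewrite /P preS drop_rcons ?size_pre //.
  rewrite /comp foldr_rcons -/(comp _ _) step_e.
  by have := (pickP (pre m)).2 n; rewrite size_pre; exact.
(* The tail words starting at the [n]-th letter form a Cauchy sequence. *)
have h n : exists h : T, P n m @[m --> \oo] --> h.
  have [l hl] := geometric_steps_cvg cM (@PS n).
  have gl : g (f (P n m)) @[m --> \oo] --> g l
    by exact: continuous_cvg (gc l) hl.
  exists (g l); apply: cvg_trans gl.
  by apply: near_eq_cvg; near=> m; rewrite fK.
have [hs hsP] := choice h.
have haus : hausdorff_space T.
  move=> p q pq; rewrite -(fK p) -(fK q); congr g; apply: metric_hausdorff.
  move=> A B Ap Bq; have [x [xA xB]] := pq _ _ (fc _ _ Ap) (fc _ _ Bq).
  by exists (f x).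
have hsE n : hs n = step (gs n) (hs n.+1).
  apply: (cvg_unique haus (hsP n)).
  have sh : step (gs n) (P n.+1 m) @[m --> \oo] --> step (gs n) (hs n.+1).
    exact: continuous_cvg (@step_cont (gs n) (hs n.+1)) (hsP n.+1).
  apply: cvg_trans sh; apply: near_eq_cvg; near=> m; rewrite /P.
  have nm : (n < m)%N by near: m; exact: nbhs_infty_gt.
  have preE k : (n < k)%N -> nth e (pre k) n = gs n.
    elim: k => // k IH; rewrite ltnS leq_eqVlt preS nth_rcons size_pre.
    case: ltnP => [nk _|kn]; first exact: IH.
    by rewrite orbF => /eqP ->; rewrite eqxx.
  by rewrite [drop n _](drop_nth e) ?size_pre// preE.
pose N n := ell1 (phi (hs n)).
have gs0 n : phi (gs n) <> (fun=> 0) by exact: (pickP (pre n)).1.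
have phihs n : phi (hs n) = fun i =>
  phi (gs n) i + phi (hs n.+1) i *+ mult (gs n).
  by apply/funext => i; rewrite {1}hsE phiM phi_pow.
have Nineq n : (mult (gs n) * N n.+1 <= N n + ell1 (phi (gs n)))%N.
  by rewrite /N (phihs n); apply: ell1D_ge.
(* Either the next limit has trivial image, and the letter alone counts, or
   the exponent makes its contribution dominate that of the letter. *)
have N_gt0 n : (0 < N n)%N.
  have [N1|N1] := posnP (N n.+1); last by have := Nineq n; rewrite /mult; nia.
  rewrite lt0n; apply/eqP => /(ell1_eq0 (phifin _)) n0; apply: (@gs0 n).
  rewrite -n0 phihs (ell1_eq0 (phifin _) N1).
  by apply/funext => i; rewrite mul0rn addr0.
have N_dec n : (N n.+1 < N n)%N.
  by have := Nineq n; have := N_gt0 n.+1; rewrite /mult; nia.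
have N_le n : (N n + n <= N 0)%N.
  by elim: n => [|n IH]; [rewrite addn0|have := N_dec n; lia].
by have := N_le (N 0%N).+1; lia.
Unshelve. all: by end_near. Qed.

(** Left translation by [inv x] is continuous and takes [x] to [e], so that
    local triviality at [e] makes [phi] constant near [x]; every value of [phi]
    is then taken on a countable dense set. *)
Theorem hom_free_abelian_countable : polish R T -> countable (range phi).
Proof.
move=> [[S cS dS] cmT]; have U := hom_locally_trivial cmT.
apply: sub_countable cS; apply: card_le_trans (card_image_le phi S).
apply: subset_card_le => _ [x _ <-].
have : \forall y \near x, phi y = phi x.
  have c : op (inv x) y @[y --> x] --> e.
    rewrite -(opV x).
    exact: (@op_cvg _ (nbhs x) (cst (inv x)) id _ x _ (cvg_cst _)
      (@cvg_id _ _)).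
  have V : nbhs x [set y | phi (op (inv x) y) = fun=> 0] := c _ U.
  apply: filterS V => y /= y0.
  apply/funext => i; have := congr1 (fun f => f i) y0; rewrite phiM => h.
  have := congr1 (fun f => f i) phi1; rewrite -(opV x) phiM => h'.
  by apply: (addrI (phi (inv x) i)); rewrite h h'.
rewrite /prop_near1 nbhsE => -[W [oW Wx] WP].
have [s [Ws Ss]] := dS W (ex_intro _ x Wx) oW.
by exists s => //; exact: WP.
Qed.

End automatic_continuity.

(** * Real-valued modulus and complex differentiability *)

Section modulus.
Variable R : realType.
Local Notation C := (Cplx R).
Implicit Types (z w : C) (x y s : R).

Definition re z : R := complex.Re z.
Definition im z : R := complex.Im z.
Definition pt x y : C := Complex x y.
(** The norm of a complex number is itself complex; its real part is the usual
    modulus, on which real arithmetic is available. *)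
Definition cmod z : R := complex.Re `|z|.

Lemma cmodE z : `|z| = pt (cmod z) 0.
Proof. by rewrite /cmod /pt normc_def. Qed.

Lemma cmod_def z : cmod z = Num.sqrt (re z ^+ 2 + im z ^+ 2).
Proof. by rewrite /cmod normc_def. Qed.

Lemma cmod_ge0 z : 0 <= cmod z.
Proof. by rewrite cmod_def sqrtr_ge0. Qed.

Lemma cmodM z w : cmod (z * w) = cmod z * cmod w.
Proof. by have := normrM z w; rewrite !cmodE => -[]; rewrite !mulr0 subr0. Qed.

Lemma cmodD z w : cmod (z + w) <= cmod z + cmod w.
Proof. by have := ler_normD z w; rewrite !cmodE lecE /= addr0 eqxx. Qed.

Lemma cmod0 : cmod 0 = 0.
Proof. by rewrite /cmod normr0. Qed.

Lemma cmod1 : cmod 1 = 1.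
Proof. by rewrite /cmod normr1. Qed.

Lemma cmodN z : cmod (- z) = cmod z.
Proof. by rewrite /cmod normrN. Qed.

Lemma cmod_eq0 z : (cmod z == 0) = (z == 0).
Proof.
rewrite -[z == 0]normr_eq0 cmodE; apply/eqP/eqP => [-> //|].
by case.
Qed.

Lemma cmod_gt0 z : (0 < cmod z) = (z != 0).
Proof. by rewrite lt_def cmod_ge0 andbT cmod_eq0. Qed.

Lemma cmodB z w : cmod (z - w) = cmod (w - z).
Proof. by rewrite -cmodN opprB. Qed.

Lemma cmodB_ge z w : cmod z - cmod w <= cmod (z - w).
Proof. by rewrite lerBlDr (le_trans _ (cmodD _ _)) // subrK. Qed.

Lemma cmodV z : cmod z^-1 = (cmod z)^-1.
Proof.
have [->|z0] := eqVneq z 0; first by rewrite !(invr0, cmod0).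
by apply: (mulfI (x := cmod z));
  rewrite ?cmod_eq0// -cmodM divff// cmod1 divff ?cmod_eq0.
Qed.

Lemma cmodX z n : cmod (z ^+ n) = cmod z ^+ n.
Proof. by elim: n => [|n IH]; rewrite ?cmod1// !exprS cmodM IH. Qed.

Lemma cmodXz z (n : int) : cmod (z ^ n) = cmod z ^ n.
Proof. by case: n => n; rewrite -?exprnP ?cmodX// !NegzE -!exprnN cmodV cmodX.
  Qed.

Lemma sqr_cmod z : cmod z ^+ 2 = re z ^+ 2 + im z ^+ 2.
Proof. by rewrite cmod_def sqr_sqrtr// addr_ge0 ?sqr_ge0. Qed.

Lemma re_cmod z : `|re z| <= cmod z.
Proof. by rewrite cmod_def -sqrtr_sqr ler_wsqrtr// lerDl sqr_ge0. Qed.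

Lemma im_cmod z : `|im z| <= cmod z.
Proof. by rewrite cmod_def -sqrtr_sqr ler_wsqrtr// lerDr sqr_ge0. Qed.

Lemma cmod_le z : cmod z <= `|re z| + `|im z|.
Proof.
rewrite -(ler_pXn2r (n := 2)) ?nnegrE ?cmod_ge0 ?addr_ge0// sqr_cmod sqrrD.
rewrite !real_normK ?num_real//.
by have := mulr_ge0 (normr_ge0 (re z)) (normr_ge0 (im z)); lra.
Qed.

Lemma reD z w : re (z + w) = re z + re w. Proof. by case: z w => ? ? []. Qed.
Lemma imD z w : im (z + w) = im z + im w. Proof. by case: z w => ? ? []. Qed.
Lemma reN z : re (- z) = - re z. Proof. by case: z. Qed.
Lemma imN z : im (- z) = - im z. Proof. by case: z. Qed.
Lemma imM z w : im (z * w) = re z * im w + im z * re w.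
Proof. by case: z w => ? ? []. Qed.
Lemma reV z : re z^-1 = re z / cmod z ^+ 2.
Proof. by rewrite sqr_cmod; case: z. Qed.
Lemma imV z : im z^-1 = - im z / cmod z ^+ 2.
Proof. by rewrite sqr_cmod; case: z => x y /=; rewrite mulNr. Qed.
Lemma re_pt x y : re (pt x y) = x. Proof. by []. Qed.
Lemma im_pt x y : im (pt x y) = y. Proof. by []. Qed.

Definition reimE := (reD, imD, reN, imN, re_pt, im_pt).

Lemma nbhs_cmodP (a : C) (P : set C) :
  nbhs a P <-> exists2 e : R, 0 < e & forall z, cmod (z - a) < e -> P z.
Proof.
split=> [/nbhs_normP[e /= e0 eP]|[e e0 eP]]; last apply/nbhs_normP.
  exists (complex.Re e).
    by move: e0; rewrite ltcE => /andP[].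
  move=> z za; apply: eP => /=; rewrite -normrN opprB cmodE.
  by case: e e0 za => x y; rewrite !ltcE /= => /andP[/eqP -> _]; rewrite eqxx.
exists (pt e 0); first by rewrite /= ltcE /= eqxx.
move=> z /=; rewrite -normrN opprB cmodE ltcE /= eqxx /= => za; exact: eP.
Qed.

Lemma dnbhs_cmodP (a : C) (P : set C) :
  a^' P <-> exists2 e : R, 0 < e & forall z, z != a -> cmod (z - a) < e -> P z.
Proof.
split=> [/nbhs_cmodP[e e0 h]|[e e0 h]]; first by exists e => // z za zae;
  exact: h.
by apply/nbhs_cmodP; exists e => // z zae za; exact: h.
Qed.

(** First-order expansion at [a] with errors measured by [cmod]. *)
Definition cdiff (f : C -> C) (a : C) := exists d, forall e : R, 0 < e ->
  exists2 r : R, 0 < r & forall z, cmod (z - a) < r ->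
    cmod (f z - f a - d * (z - a)) <= e * cmod (z - a).

Lemma cdiffP (f : C -> C) (a : C) : derivable f a 1 <-> cdiff f a.
Proof.
split=> [df|[d df]].
  exists (lim (h^-1 *: (f (h *: 1 + a) - f a) @[h --> 0^'])) => e e0.
  have := df; rewrite /derivable; set l := lim _;
    move=> /cvgrPdist_le/(_ (pt e 0)).
  have pe : 0 < pt e 0 by rewrite ltcE /= eqxx.
  move=> /(_ pe)/dnbhs_cmodP[r r0 h]; exists r => // z zr.
  have [->|za] := eqVneq z a; first by rewrite !subrr mulr0 subr0 cmod0 mulr0.
  have za0 : z - a != 0 by rewrite subr_eq0.
  move: (h (z - a)); rewrite subr0 => /(_ za0 zr);
    rewrite cmodE lecE /= eqxx /=.
  rewrite [_ *: 1]mulr1 subrK => hz.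
  have -> : f z - f a - l * (z - a) =
    - ((l - (z - a)^-1 * (f z - f a)) * (z - a)).
    by field.
  by rewrite cmodN cmodM ler_wpM2r ?cmod_ge0.
apply/cvg_ex; exists d; apply/cvgrPdist_le => e e0.
have {e0} : 0 < re e /\ e = pt (re e) 0.
  by move: e0; case: e => x y; rewrite ltcE /= => /andP[/eqP -> ].
move=> [e0 ->]; have [r r0 h] := df _ e0.
apply/dnbhs_cmodP; exists r => // z z0; rewrite subr0 => zr;
  rewrite cmodE lecE /= eqxx /=.
have := h (z + a); rewrite addrK => /(_ zr); rewrite [_ *: 1]mulr1.
have -> : f (z + a) - f a - d * z = - ((d - z^-1 * (f (z + a) - f a)) * z).
  by field.
by rewrite cmodN cmodM ler_pM2r ?cmod_gt0.
Qed.

End modulus.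

(** * Midpoint sums along the boundary of a square *)

Section contour.
Variable R : realType.
Local Notation C := (Cplx R).
Implicit Types (f g : C -> C) (z w d : C) (x y s t : R).

(** The midpoint rule with [2 ^ n] steps for the integral of [f] along the
    segment from [z] to [z + pt x y]. The recursion on halves makes additivity
    under bisection definitional. *)
Fixpoint seg f z x y n : C :=
  if n is n'.+1 then
    seg f z (x / 2) (y / 2) n' +
    seg f (z + pt (x / 2) (y / 2)) (x / 2) (y / 2) n'
  else f (z + pt (x / 2) (y / 2)) * pt x y.

Definition contour f z s n : C :=
  seg f z s 0 n + seg f (z + pt s 0) 0 s n
  - seg f (z + pt 0 s) s 0 n - seg f z 0 s n.

Lemma ptD x y x' y' : pt x y + pt x' y' = pt (x + x') (y + y').
Proof. by []. Qed.

Lemma segD f g c z x y n :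
  seg (fun w => f w + c * g w) z x y n = seg f z x y n + c * seg g z x y n.
Proof. by elim: n z x y => [|n IH] z x y /=; rewrite ?IH; ring. Qed.

Lemma segN f z x y n : seg (fun w => - f w) z x y n = - seg f z x y n.
Proof. by elim: n z x y => [|n IH] z x y /=; rewrite ?IH ?opprD ?mulNr. Qed.

(** The midpoint rule is exact on affine functions. *)
Lemma seg_affine p q z x y n :
  seg (fun w => p + q * w) z x y n =
    (p + q * (z + pt (x / 2) (y / 2))) * pt x y.
Proof.
elim: n z x y => [|n IH] z x y //=; rewrite !IH.
have e : pt x y = pt (x / 2) (y / 2) + pt (x / 2) (y / 2).
  by rewrite ptD -!splitr.
rewrite [pt x y]e.
have -> : pt (x / 2) (y / 2) =
  pt (x / 2 / 2) (y / 2 / 2) + pt (x / 2 / 2) (y / 2 / 2).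
  by rewrite ptD -!splitr.
ring.
Qed.

Lemma cmod_pt x y : cmod (pt x y) <= `|x| + `|y|.
Proof. exact: cmod_le. Qed.

Lemma cmod_seg f z x y n M :
  (forall t, 0 <= t <= 1 -> cmod (f (z + pt (t * x) (t * y))) <= M) ->
  cmod (seg f z x y n) <= M * (`|x| + `|y|).
Proof.
elim: n z x y => [|n IH] z x y h /=.
  rewrite cmodM ler_pM ?cmod_ge0 ?cmod_pt// ![_ / 2]mulrC.
  by apply: h; lra.
have -> : M * (`|x| + `|y|) =
  M * (`|x / 2| + `|y / 2|) + M * (`|x / 2| + `|y / 2|).
  by rewrite !normrM !(ger0_norm (x := 2^-1)) ?invr_ge0//; field.
apply: le_trans (cmodD _ _) _; apply: lerD; apply: IH => t t01.
  have -> : pt (t * (x / 2)) (t * (y / 2)) = pt (t / 2 * x) (t / 2 * y).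
    by congr pt; ring.
  by apply: h; lra.
rewrite -addrA ptD.
have -> : pt (x / 2 + t * (x / 2)) (y / 2 + t * (y / 2)) =
    pt ((1 + t) / 2 * x) ((1 + t) / 2 * y) by congr pt; field.
by apply: h; lra.
Qed.

Lemma im_seg f z x y n c :
  (forall t, 0 <= t <= 1 -> c <= im (f (z + pt (t * x) (t * y)) * pt x y)) ->
  c <= im (seg f z x y n).
Proof.
elim: n z x y c => [|n IH] z x y c h /=.
  by rewrite ![_ / 2]mulrC; apply: h; lra.
have half w : c <= im (w * pt x y) -> c / 2 <= im (w * pt (x / 2) (y / 2)).
  rewrite !imM /re /im /=; lra.
rewrite imD; have -> : c = c / 2 + c / 2 by field.
apply: lerD; apply: IH => t t01; apply: half.
  have -> : pt (t * (x / 2)) (t * (y / 2)) = pt (t / 2 * x) (t / 2 * y).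
    by congr pt; ring.
  by apply: h; lra.
rewrite -addrA ptD.
have -> : pt (x / 2 + t * (x / 2)) (y / 2 + t * (y / 2)) =
    pt ((1 + t) / 2 * x) ((1 + t) / 2 * y) by congr pt; field.
by apply: h; lra.
Qed.

Definition square z s : set C :=
  [set w | re z <= re w <= re z + s /\ im z <= im w <= im z + s].

Definition square_edge z s : set C := square z s `&`
  [set w | [\/ re w = re z, re w = re z + s, im w = im z | im w = im z + s]].

Lemma contourD f g c z s n :
  contour (fun w => f w + c * g w) z s n =
    contour f z s n + c * contour g z s n.
Proof. by rewrite /contour !segD; ring. Qed.

(** The exact sums of an affine function are the increments of a primitive,
    which cancel around the square. *)
Lemma contour_affine p q z s n : contour (fun w => p + q * w) z s n = 0.
Proof.
rewrite /contour !seg_affine !mul0r.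
have e x y : pt x y = pt x 0 + pt 0 y by rewrite ptD addr0 add0r.
have -> : pt s 0 = pt (s / 2) 0 + pt (s / 2) 0 by rewrite ptD -splitr addr0.
have -> : pt 0 s = pt 0 (s / 2) + pt 0 (s / 2) by rewrite ptD -splitr addr0.
ring.
Qed.

(** The inner edges of the four quarters are run through twice, in opposite
    directions and with the same sample points, so that they cancel. *)
Lemma contour_quarter f z s n : contour f z s n.+1 =
  contour f z (s / 2) n + contour f (z + pt (s / 2) 0) (s / 2) n +
  contour f (z + pt 0 (s / 2)) (s / 2) n +
  contour f (z + pt (s / 2) (s / 2)) (s / 2) n.
Proof.
rewrite /contour /= !mul0r -!addrA !ptD !addr0 !add0r -!splitr.
ring.
Qed.

Lemma cmod_contour f z s n M : 0 <= s ->
  (forall w, square_edge z s w -> cmod (f w) <= M) ->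
  cmod (contour f z s n) <= 4 * s * M.
Proof.
move=> s0 h.
have ts t : 0 <= t <= 1 -> 0 <= t * s <= s.
  by move=> /andP[t0 t1]; rewrite mulr_ge0//= ler_piMl.
have e1 : M * s = M * (`|s| + `|0 : R|) by rewrite normr0 addr0 ger0_norm.
have e2 : M * s = M * (`|0 : R| + `|s|) by rewrite normr0 add0r ger0_norm.
have l1 : cmod (seg f z s 0 n) <= M * s.
  rewrite e1.
  apply: cmod_seg => t /ts t01; apply: h; rewrite mulr0; split.
    by split; rewrite !reimE /re /im /=; lra.
  by apply: Or43; rewrite imD /im /= addr0.
have l2 : cmod (seg f (z + pt s 0) 0 s n) <= M * s.
  rewrite e2.
  apply: cmod_seg => t /ts t01; apply: h; rewrite mulr0; split.
    by split; rewrite !reimE /re /im /=; lra.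
  by apply: Or42; rewrite !reD /re /= addr0.
have l3 : cmod (seg f (z + pt 0 s) s 0 n) <= M * s.
  rewrite e1.
  apply: cmod_seg => t /ts t01; apply: h; rewrite mulr0; split.
    by split; rewrite !reimE /re /im /=; lra.
  by apply: Or44; rewrite !imD /im /= addr0.
have l4 : cmod (seg f z 0 s n) <= M * s.
  rewrite e2.
  apply: cmod_seg => t /ts t01; apply: h; rewrite mulr0; split.
    by split; rewrite !reimE /re /im /=; lra.
  by apply: Or41; rewrite !reD /re /= addr0.
rewrite /contour.
have := cmodD (seg f z s 0 n) (seg f (z + pt s 0) 0 s n).
have := cmodD (seg f z s 0 n + seg f (z + pt s 0) 0 s n)
  (- seg f (z + pt 0 s) s 0 n).
have := cmodD (seg f z s 0 n + seg f (z + pt s 0) 0 s n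
  - seg f (z + pt 0 s) s 0 n) (- seg f z 0 s n).
rewrite !cmodN; lra.
Qed.

Lemma square_cover z s w : square z s w ->
  [\/ square z (s / 2) w, square (z + pt (s / 2) 0) (s / 2) w,
      square (z + pt 0 (s / 2)) (s / 2) w |
      square (z + pt (s / 2) (s / 2)) (s / 2) w].
Proof.
move=> [h1 h2].
have [lx|lx] := leP (re w) (re z + s / 2);
  have [ly|ly] := leP (im w) (im z + s / 2);
  [apply: Or41|apply: Or43|apply: Or42|apply: Or44]; split; rewrite ?reimE; lra.
Qed.

(** Cousin's principle: otherwise repeated bisection yields nested bad squares,
    which shrink to a point and contradict the local hypothesis there. It serves
    as compactness and as connectedness of the square. *)
Lemma square_induction (P : C -> R -> Prop) z0 s0 : 0 < s0 ->
  (forall z s, 0 < s -> P z (s / 2) -> P (z + pt (s / 2) 0) (s / 2) ->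
    P (z + pt 0 (s / 2)) (s / 2) ->
    P (z + pt (s / 2) (s / 2)) (s / 2) -> P z s) ->
  (forall a, square z0 s0 a -> exists2 r, 0 < r &
     forall z s, 0 < s < r -> square z s a -> P z s) ->
  P z0 s0.
Proof.
move=> s00 Pq Pl; apply: contrapT => nP.
pose bad (u : C * R) := 0 < u.2 /\ ~ P u.1 u.2.
pose sub (u v : C * R) := v.2 = u.2 / 2 /\
  (re u.1 <= re v.1 <= re u.1 + u.2 / 2 /\
   im u.1 <= im v.1 <= im u.1 + u.2 / 2).
have next u : exists v, bad u -> bad v /\ sub u v.
  case: (pselect (bad u)) => [[u0 nPu]|nb]; last by exists u.
  apply: contrapT => nv; apply: nPu; have u2 : 0 < u.2 / 2 by rewrite divr_gt0.
  have good x y : (x = 0 \/ x = u.2 / 2) -> (y = 0 \/ y = u.2 / 2) ->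
      P (u.1 + pt x y) (u.2 / 2).
    move=> hx hy; apply: contrapT => nPx; apply: nv.
    exists (u.1 + pt x y, u.2 / 2) => _; split; first by split.
    split=> //=; rewrite !reimE /re /im /=.
    by case: hx => ->; case: hy => ->; lra.
  apply: Pq => //; try by apply: good; auto.
  by rewrite -[u.1]addr0; apply: good; left.
have [nx nxP] := choice next.
pose U n := iter n nx (z0, s0).
have badU n : bad (U n) by elim: n => [//|n /nxP[]].
have subU n : sub (U n) (U n.+1) by have [] := nxP _ (badU n).
have sU n : (U n).2 = s0 / 2 ^+ n.
  elim: n => [|n IH]; first by rewrite expr0 divr1.
  by rewrite (subU n).1 IH exprS; field.
have mono n k :
   re (U n).1 <= re (U (n + k)%N).1 /\ im (U n).1 <= im (U (n + k)%N).1 /\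
   re (U (n + k)%N).1 + (U (n + k)%N).2 <= re (U n).1 + (U n).2 /\
   im (U (n + k)%N).1 + (U (n + k)%N).2 <= im (U n).1 + (U n).2.
  elim: k => [|k]; first by rewrite addn0; lra.
  rewrite addnS; have [-> [? ?]] := subU (n + k)%N; lra.
(* Lower left corners stay below upper right ones, in both coordinates, so
   the nested squares have a common point. *)
have le_all (p : C -> R) : (p = @re R \/ p = @im R) ->
  forall m n, p (U m).1 <= p (U n).1 + (U n).2.
  move=> hp m n.
  have [mn|/ltnW nm] := leqP m n.
    have := mono m (n - m)%N; rewrite (subnKC mn); have := (badU n).1.
    by case: hp => -> /=; lra.
  have := mono n (m - n)%N; rewrite (subnKC nm); have := (badU m).1.
  by case: hp => -> /=; lra.
have lim (p : C -> R) : (p = @re R \/ p = @im R) ->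
    exists l, forall n, p (U n).1 <= l <= p (U n).1 + (U n).2.
  move=> hp; have := le_all _ hp => {}hp.
  pose S := range (fun n => p (U n).1).
  have S0 : S !=set0 by exists (p (U 0%N).1); exists 0%N.
  exists (sup S) => n; apply/andP; split.
    apply: ub_le_sup; last by exists n.
    by exists (p (U 0%N).1 + (U 0%N).2) => _ [m _ <-].
  by apply: ge_sup => // _ [m _ <-].
have [l1 h1] := lim _ (or_introl erefl);
  have [l2 h2] := lim _ (or_intror erefl).
have [|r r0 hr] := Pl (pt l1 l2).
  by split; [exact: (h1 0%N)|exact: (h2 0%N)].
have [n sn] : exists n, (U n).2 < r.
  have [n _ hn] : \forall n \near \oo, (2^-1 : R) ^+ n < r / s0.
    have /cvgrPdist_lt/(_ (r / s0)) : (2^-1 : R) ^+ n @[n --> \oo] --> (0 : R).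
      by apply: cvg_expr; rewrite gtr0_norm ?invf_lt1 ?ltr1n.
    move=> /(_ ltac:(by rewrite divr_gt0)); apply: filterS => m.
    by rewrite sub0r normrN ger0_norm ?exprn_ge0 ?invr_ge0.
  exists n; rewrite sU -exprVn mulrC -ltr_pdivlMr//; exact: hn (leqnn n).
apply: (badU n).2; apply: hr; first by rewrite sn (badU n).1.
by split; [exact: h1|exact: h2].
Qed.

End contour.

(** * The theorem of Goursat *)

Section goursat.
Variable R : realType.
Local Notation C := (Cplx R).
Implicit Types (f g : C -> C) (z w d a : C) (x y s t : R).

Definition locally_bounded f a := exists M r : R, 0 < r /\
  forall z, cmod (z - a) < r -> cmod (f z) <= M.

Lemma cdiff_locally_bounded f a : cdiff f a -> locally_bounded f a.
Proof.
move=> [d /(_ 1 ltr01)[r r0 h]]; exists (cmod (f a) + (1 + cmod d) * r), r;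
  split=> // z zr.
have -> : f z = (f z - f a - d * (z - a)) + f a + d * (z - a) by ring.
have := cmodD ((f z - f a - d * (z - a)) + f a) (d * (z - a)).
have := cmodD (f z - f a - d * (z - a)) (f a).
have := h _ zr; rewrite (cmodM d).
have : cmod d * cmod (z - a) <= cmod d * r by rewrite ler_wpM2l ?cmod_ge0 ?ltW.
have := cmod_ge0 d; lra.
Qed.

Lemma square_cmod z s w a : square z s w -> square z s a ->
  cmod (w - a) <= 2 * s.
Proof.
move=> [hw1 hw2] [ha1 ha2]; apply: le_trans (cmod_le _) _; rewrite !reimE.
have : `|re w - re a| <= s by rewrite ler_norml; lra.
have : `|im w - im a| <= s by rewrite ler_norml; lra.
lra.
Qed.

(** The increment of [jump] over a closed interval is at least 1 when the
    interval contains 0, even as an endpoint. *)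
Definition jump x : R := (0 < x)%R%:R + (0 <= x)%R%:R.
Definition jump_incr x s := jump (x + s) - jump x.

Lemma jump_incrD x s : jump_incr x s =
  jump_incr x (s / 2) + jump_incr (x + s / 2) (s / 2).
Proof.
rewrite /jump_incr -[x + s / 2 + s / 2]addrA -splitr; ring.
Qed.

Lemma jump_incr_ge0 x s : 0 <= s -> 0 <= jump_incr x s.
Proof.
move=> s0; rewrite /jump_incr /jump subr_ge0.
apply: lerD.
  by case: (ltP 0 x) => h //=; have -> : 0 < x + s by lra.
by case: (leP 0 x) => h //=; have -> : 0 <= x + s by lra.
Qed.

Lemma jump_incr_le2 x s : jump_incr x s <= 2.
Proof.
rewrite /jump_incr /jump.
by case: (0 < x + s) (0 <= x + s) (0 < x) (0 <= x) => [] [] [] [] /=; lra.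
Qed.

Lemma jump_incr_ge1 x s : 0 < s -> x <= 0 <= x + s -> 1 <= jump_incr x s.
Proof.
move=> s0 /andP[x0 xs0]; rewrite /jump_incr /jump.
have -> : 0 < x = false by apply/negbTE; rewrite -leNgt.
rewrite xs0; case: (leP 0 x) => hx /=; last by case: (0 < x + s) => /=; lra.
have -> : 0 < x + s by lra.
by rewrite /=; lra.
Qed.

(** A weight additive under quartering, bounded, and at least 1 on every closed
    square containing [a], whether [a] lies inside or on an edge. *)
Definition point_mass a z s :=
  jump_incr (re z - re a) s * jump_incr (im z - im a) s.

Lemma point_mass_quarter a z s : point_mass a z s =
  point_mass a z (s / 2) + point_mass a (z + pt (s / 2) 0) (s / 2)
  + point_mass a (z + pt 0 (s / 2)) (s / 2)
  + point_mass a (z + pt (s / 2) (s / 2)) (s / 2).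
Proof.
rewrite /point_mass !reD !imD ![re (pt _ _)]/= ![im (pt _ _)]/= !addr0.
rewrite (jump_incrD (re z - re a)) (jump_incrD (im z - im a)).
rewrite ![_ + s / 2 - _]addrAC; ring.
Qed.

Lemma point_mass_ge0 a z s : 0 <= s -> 0 <= point_mass a z s.
Proof. by move=> s0; rewrite mulr_ge0 ?jump_incr_ge0. Qed.

Lemma point_mass_le4 a z s : 0 <= s -> point_mass a z s <= 4.
Proof.
move=> s0; have -> : (4 : R) = 2 * 2 by ring.
by rewrite ler_pM ?jump_incr_ge0 ?jump_incr_le2.
Qed.

Lemma point_mass_ge1 a z s : 0 < s -> square z s a -> 1 <= point_mass a z s.
Proof.
move=> s0 [h1 h2]; rewrite -[1]mulr1 ler_pM// jump_incr_ge1//; lra.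
Qed.

(** Bisection shows that the sums on [square z s] are eventually bounded by a
    small multiple of the area plus the point masses at [E]. Near a point of
    differentiability the affine part contributes nothing and the remainder is
    small against the area; near a point of [E] the sums are at most the
    perimeter times a bound of [f], small against the point mass. *)
Theorem goursat f z0 s0 (E : seq C) : 0 < s0 ->
  (forall a, square z0 s0 a -> cdiff f a \/ a \in E /\ locally_bounded f a) ->
  forall e, 0 < e -> exists n0, forall n, (n0 <= n)%N ->
    cmod (contour f z0 s0 n) <= e.
Proof.
move=> s00 hf e e0.
pose wt z s : R := s ^+ 2 + \sum_(a <- E) point_mass a z s.
pose c : R := e / (s0 ^+ 2 + 4 * (size E)%:R + 1).
have den0 : 0 < s0 ^+ 2 + 4 * (size E)%:R + 1.
  by rewrite ltr_wpDl// addr_ge0 ?sqr_ge0// mulr_ge0.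
have c0 : 0 < c by rewrite divr_gt0.
have [n0 h] : exists n0, forall n, (n0 <= n)%N ->
  cmod (contour f z0 s0 n) <= c * wt z0 s0.
  apply: (@square_induction R (fun z s => exists n0, forall n, (n0 <= n)%N ->
    cmod (contour f z s n) <= c * wt z s)) => //.
    move=> z s sp [n1 h1] [n2 h2] [n3 h3] [n4 h4].
    exists (maxn (maxn n1 n2) (maxn n3 n4)).+1 => -[//|n];
      rewrite ltnS !geq_max.
    move=> /andP[/andP[/h1 {}h1 /h2 {}h2] /andP[/h3 {}h3 /h4 {}h4]].
    have -> : wt z s = wt z (s / 2) + wt (z + pt (s / 2) 0) (s / 2)
      + wt (z + pt 0 (s / 2)) (s / 2) + wt (z + pt (s / 2) (s / 2)) (s / 2).
      rewrite /wt (eq_bigr _ (fun a _ => point_mass_quarter a z s)).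
      rewrite !big_split /=.
      by field.
    have D4 (p q u v : C) : cmod (p + q + u + v) <=
      cmod p + cmod q + cmod u + cmod v.
      have := cmodD (p + q + u) v; have := cmodD (p + q) u; have := cmodD p q;
        lra.
    by rewrite contour_quarter; apply: le_trans (D4 _ _ _ _) _; lra.
  move=> a /hf[[d /(_ (c / 8) ltac:(by rewrite divr_gt0))[r r0 hd]]|
    [aE [M [r [r0 hM]]]]].
    exists (r / 2); first by rewrite divr_gt0.
    move=> z s /andP[sp sr] za; exists 0%N => n _.
    pose g w := f w - f a - d * (w - a).
    have -> : f = (fun w => (f a - d * a + d * w) + 1 * g w).
      by apply/funext => w; rewrite /g; ring.
    rewrite contourD contour_affine add0r mul1r.
    have : cmod (contour g z s n) <= 4 * s * (c / 8 * (2 * s)).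
      apply: cmod_contour => [|w [zw _]]; first exact: ltW.
      have wa := square_cmod zw za.
      apply: le_trans (hd w _) _; first by lra.
      by rewrite ler_wpM2l// ltW// divr_gt0.
    move/le_trans; apply; rewrite /wt mulrDr.
    have -> : 4 * s * (c / 8 * (2 * s)) = c * s ^+ 2 by field.
    rewrite lerDl; apply: mulr_ge0; first exact: ltW.
    by apply: sumr_ge0 => b _; exact/point_mass_ge0/ltW.
  exists (Num.min (r / 2) (c / (4 * (`|M| + 1)))).
    by rewrite lt_min !divr_gt0// mulr_gt0// ltr_wpDl.
  move=> z s /andP[sp]; rewrite lt_min => /andP[sr sM] za; exists 0%N => n _.
  have : cmod (contour f z s n) <= 4 * s * (`|M| + 1).
    apply: cmod_contour => [|w [zw _]]; first exact: ltW.
    have wa := square_cmod zw za.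
    apply: le_trans (hM _ _) _; first by lra.
    by apply: le_trans (ler_norm _) _; rewrite lerDl.
  move/le_trans; apply; rewrite ltr_pdivlMr in sM;
    last by rewrite mulr_gt0// ltr_wpDl.
  apply: (@le_trans _ _ c); first by lra.
  rewrite -{1}[c]mulr1; apply: ler_wpM2l; [exact: ltW|rewrite /wt].
  rewrite (big_rem a aE) /=.
  have := point_mass_ge1 sp za; have : 0 < s ^+ 2 by rewrite exprn_gt0.
  have : 0 <= \sum_(b <- rem a E) point_mass b z s.
    by apply: sumr_ge0 => b _; exact/point_mass_ge0/ltW.
  lra.
exists n0 => n /h /le_trans; apply; rewrite /c -mulrA ler_piMr ?(ltW e0)//.
rewrite mulrC ler_pdivrMr// mul1r /wt.
have : \sum_(a <- E) point_mass a z0 s0 <= 4 * (size E)%:R.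
  rewrite mulr_natr -[4 *+ _]addr0 -iter_addr -count_predT -big_const_seq.
  by apply: ler_sum => a _; exact/point_mass_le4/ltW.
lra.
Qed.

End goursat.

(** * Cauchy estimates *)

Section cauchy.
Variable R : realType.
Local Notation C := (Cplx R).
Implicit Types (f g : C -> C) (z w d a : C) (x y s t : R).

Lemma cdiff_cst d a : cdiff (fun=> d : C) a.
Proof. by apply/cdiffP; exact: derivable_cst. Qed.

Lemma cdiffB f g a : cdiff f a -> cdiff g a -> cdiff (fun z => f z - g z) a.
Proof. by move=> /cdiffP df /cdiffP dg; apply/cdiffP;
  exact: (derivableB df dg). Qed.

Lemma cdiffM f g a : cdiff f a -> cdiff g a -> cdiff (fun z => f z * g z) a.
Proof. by move=> /cdiffP df /cdiffP dg; apply/cdiffP;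
  exact: (derivableM df dg). Qed.

Lemma cdiff_id a : cdiff id a.
Proof. by apply/cdiffP; exact: derivable_id. Qed.

Lemma cdiffV f a : f a != 0 -> cdiff f a -> cdiff (fun z => (f z)^-1) a.
Proof. by move=> fa /cdiffP df; apply/cdiffP; exact: (derivableV fa df). Qed.

Lemma cdiffX f a n : cdiff f a -> cdiff (fun z => f z ^+ n) a.
Proof.
move=> df; elim: n => [|n IH]; first exact: cdiff_cst.
have -> : (fun z => f z ^+ n.+1) = (fun z => f z * f z ^+ n).
  by apply/funext => z; rewrite exprS.
exact: cdiffM.
Qed.

Lemma cdiff_subid c a : cdiff (fun z => z - c) a.
Proof. exact: (cdiffB (cdiff_id a) (cdiff_cst c a)). Qed.

Lemma locally_boundedM f g a : locally_bounded f a -> locally_bounded g a ->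
  locally_bounded (fun z => f z * g z) a.
Proof.
move=> [M [r [r0 hf]]] [N [s [s0 hg]]].
exists (`|M| * `|N|), (Num.min r s); split; first by rewrite lt_min r0.
move=> z; rewrite lt_min => /andP[zr zs]; rewrite cmodM ler_pM ?cmod_ge0//.
  exact: le_trans (hf _ zr) (ler_norm _).
exact: le_trans (hg _ zs) (ler_norm _).
Qed.

Lemma locally_boundedB f g a : locally_bounded f a -> locally_bounded g a ->
  locally_bounded (fun z => f z - g z) a.
Proof.
move=> [M [r [r0 hf]]] [N [s [s0 hg]]].
exists (M + N), (Num.min r s); split; first by rewrite lt_min r0.
move=> z; rewrite lt_min => /andP[zr zs]; apply: le_trans (cmodD _ _) _.
by rewrite cmodN lerD ?hf ?hg.
Qed.

(** The Cauchy kernel turns a point of differentiability into an exceptional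
    point of the kind that [goursat] tolerates. *)
Lemma locally_bounded_quotient f a : cdiff f a ->
  locally_bounded (fun z => (f z - f a) / (z - a)) a.
Proof.
move=> [d /(_ 1 ltr01)[r r0 h]]; exists (1 + cmod d), r; split=> // z zr.
have [->|za] := eqVneq z a.
  by rewrite !subrr mul0r cmod0 addr_ge0 ?cmod_ge0.
have za0 : z - a != 0 by rewrite subr_eq0.
have -> : (f z - f a) / (z - a) = (f z - f a - d * (z - a)) / (z - a) + d
  by field.
apply: le_trans (cmodD _ _) _;
  rewrite lerD2r cmodM cmodV ler_pdivrMr ?cmod_gt0//.
exact: h.
Qed.

Definition box a r := square (a - pt r r) (2 * r).
Definition box_edge a r := square_edge (a - pt r r) (2 * r).

Lemma box_edge_far a r w z : 0 < r -> box a (r / 2) w -> box_edge a r z ->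
  r / 2 <= cmod (z - w).
Proof.
move=> r0 [w1 w2] [[z1 z2] hz].
have l1 := re_cmod (z - w); have l2 := im_cmod (z - w).
move: w1 w2 z1 z2 hz l1 l2; rewrite !reimE.
rewrite !ler_norml => w1 w2 z1 z2 [] h l1 l2; lra.
Qed.

Lemma box_far a r w z : 0 < r -> box a (r / 2) w -> box a r z ->
  `|re z - re w| <= 3 * r / 2 /\ `|im z - im w| <= 3 * r / 2.
Proof.
move=> r0 [w1 w2] [z1 z2].
move: w1 w2 z1 z2; rewrite !reimE.
rewrite !ler_norml => w1 w2 z1 z2; lra.
Qed.

(** A lower bound on the winding number: seen from [w], each of the four edges
    turns counterclockwise, and contributes at least 2/9. *)
Lemma contour_kernel_ge a r w n : 0 < r -> box a (r / 2) w ->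
  8 / 9 <= im (contour (fun z => (z - w)^-1) (a - pt r r) (2 * r) n).
Proof.
move=> r0 ww; pose p : R := 2 / 9.
have key z x y : box_edge a r z ->
    (r / 2) * (2 * r) <= re (z - w) * y - im (z - w) * x ->
    p <= im ((z - w)^-1 * pt x y).
  move=> zb h; have h1 := box_edge_far r0 ww zb.
  have [h2 h3] := box_far r0 ww zb.1.
  have m0 : 0 < cmod (z - w) by apply: lt_le_trans h1; rewrite divr_gt0.
  have m2 : cmod (z - w) ^+ 2 <= 9 / 2 * r ^+ 2.
    rewrite sqr_cmod !reimE.
    have s2 (u : R) : `|u| <= 3 * r / 2 -> u ^+ 2 <= 9 / 4 * r ^+ 2.
      by rewrite ler_norml => hu; nra.
    by have := s2 _ h2; have := s2 _ h3; lra.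
  have -> : im ((z - w)^-1 * pt x y) =
    (re (z - w) * y - im (z - w) * x) / cmod (z - w) ^+ 2.
    by rewrite imM reV imV re_pt im_pt; ring.
  rewrite ler_pdivlMr ?exprn_gt0// /p.
  apply: le_trans (ler_wpM2l _ m2) _; first by [].
  by apply: le_trans h; lra.
have ts t : 0 <= t <= 1 -> 0 <= t * (2 * r) <= 2 * r.
  by move=> /andP[t0 t1]; rewrite mulr_ge0 ?ler_piMl//; lra.
move: (ww) => [w1 w2]; move: w1 w2; rewrite !reimE => w1 w2.
have nn : 0 < r * r by rewrite mulr_gt0.
have edge z : re a - r <= re z <= re a + r -> im a - r <= im z <= im a + r ->
    [\/ re z = re a - r, re z = re a + r, im z = im a - r | im z = im a + r] ->
    box_edge a r z.
  move=> z1 z2 z3; split; first by split; rewrite !reimE; lra.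
  case: z3 => h; [apply: Or41|apply: Or42|apply: Or43|apply: Or44];
    by rewrite !reimE h //; ring.
have l1 : p <= im (seg (fun z => (z - w)^-1) (a - pt r r) (2 * r) 0 n).
  apply: im_seg => t /ts t01; rewrite mulr0; apply: key.
    apply: edge; rewrite !reimE; try lra.
    by apply: Or43; ring.
  rewrite !reimE; nra.
have l2 : p <=
    im (seg (fun z => (z - w)^-1) (a - pt r r + pt (2 * r) 0) 0 (2 * r) n).
  apply: im_seg => t /ts t01; rewrite mulr0; apply: key.
    apply: edge; rewrite !reimE; try lra.
    by apply: Or42; ring.
  rewrite !reimE; nra.
have l3 : p <=
    im (seg (fun z => - (z - w)^-1) (a - pt r r + pt 0 (2 * r)) (2 * r) 0 n).
  apply: im_seg => t /ts t01; rewrite mulr0 mulNr -mulrN; apply: key.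
    apply: edge; rewrite !reimE; try lra.
    by apply: Or44; ring.
  rewrite !reimE; nra.
have l4 : p <= im (seg (fun z => - (z - w)^-1) (a - pt r r) 0 (2 * r) n).
  apply: im_seg => t /ts t01; rewrite mulr0 mulNr -mulrN; apply: key.
    apply: edge; rewrite !reimE; try lra.
    by apply: Or41; ring.
  rewrite !reimE; nra.
move: l3 l4; rewrite !segN !imN => l3 l4.
move: l1 l2 l3 l4; rewrite ?/contour ?imD ?imN /p; lra.
Qed.

Definition almost_holomorphic f a r (E : seq C) := forall z, box a r z ->
  (z \notin E -> cdiff f z) /\ locally_bounded f z.

(** By [goursat] the sums of [(f z - f w) / (z - w)] tend to 0, so that [f w]
    times the sums of the Cauchy kernel is close to the sums of
    [f z / (z - w)], controlled by [M]. *)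
Theorem cauchy_estimate f a r (E : seq C) M w : 0 < r ->
  almost_holomorphic f a r E -> (forall z, box_edge a r z -> cmod (f z) <= M) ->
  box a (r / 2) w -> w \notin E -> cmod (f w) <= 18 * M.
Proof.
move=> r0 hf fM ww wE; pose g z := (f z - f w) / (z - w).
have r20 : 0 < 2 * r by rewrite mulr_gt0.
have boxw : box a r w.
  move: ww => [h1 h2]; split; move: h1 h2; rewrite !reimE; lra.
have dfw : cdiff f w by exact: (hf _ boxw).1.
have ndiff z : z != w -> cdiff (fun z => (z - w)^-1) z.
  by move=> zw; apply: cdiffV; [rewrite subr_eq0|exact: cdiff_subid].
have hg z : box a r z -> cdiff g z \/ z \in w :: E /\ locally_bounded g z.
  move=> bz; have [->|zw] := eqVneq z w.
    by right; rewrite in_cons eqxx; split=> //; exact: locally_bounded_quotient.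
  have [zE|zE] := boolP (z \in E).
    right; rewrite in_cons zE orbT; split=> //.
    apply: locally_boundedM; last exact/cdiff_locally_bounded/ndiff.
    apply: locally_boundedB; first exact: (hf _ bz).2.
    exact/cdiff_locally_bounded/cdiff_cst.
  left; apply: cdiffM; last exact: ndiff.
  apply: cdiffB; [exact: (hf _ bz).1|exact: cdiff_cst].
have gE n : contour g (a - pt r r) (2 * r) n =
    contour (fun z => f z / (z - w)) (a - pt r r) (2 * r) n
    - f w * contour (fun z => (z - w)^-1) (a - pt r r) (2 * r) n.
  by rewrite -mulNr -contourD; congr contour; apply/funext => z; rewrite /g;
    ring.
apply/ler_addgt0Pr => e e0.
have e10 : 0 < 8 / 9 * e by rewrite mulr_gt0.
have [n0 /(_ n0 (leqnn _)) hn] := goursat r20 hg e10.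
have hM : cmod (contour (fun z => f z / (z - w)) (a - pt r r) (2 * r) n0)
    <= 4 * (2 * r) * (M * (2 / r)).
  apply: cmod_contour => [|z bz]; first exact: ltW.
  have far := box_edge_far r0 ww bz.
  have m0 : 0 < cmod (z - w) by apply: lt_le_trans far; rewrite divr_gt0.
  rewrite cmodM cmodV ler_pM ?cmod_ge0 ?invr_ge0 ?cmod_ge0 ?fM//.
  by rewrite -[2 / r]invrK invf_div lef_pV2 ?posrE ?divr_gt0.
have hK := contour_kernel_ge n0 r0 ww.
have hK' : 8 / 9 <=
    cmod (contour (fun z => (z - w)^-1) (a - pt r r) (2 * r) n0).
  by apply: le_trans hK _; apply: le_trans (ler_norm _) (im_cmod _).
have : cmod (f w) * (8 / 9) <=
    cmod (f w * contour (fun z => (z - w)^-1) (a - pt r r) (2 * r) n0).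
  by rewrite cmodM ler_wpM2l ?cmod_ge0.
have := cmodB_ge (f w * contour (fun z => (z - w)^-1) (a - pt r r) (2 * r) n0)
  (contour (fun z => f z / (z - w)) (a - pt r r) (2 * r) n0).
rewrite cmodB -gE.
have : 4 * (2 * r) * (M * (2 / r)) = 16 * M by field; rewrite gt_eqF.
move: hn hM; lra.
Qed.

(** The estimate applied to the difference quotient at [w'], which is bounded
    near [w'] and at most [(18 + 1) * M * (2 / r)] on the boundary; hence
    the constant 684 = 18 * 19 * 2. *)
Theorem cauchy_lipschitz f a r (E : seq C) M w w' : 0 < r ->
  almost_holomorphic f a r E -> (forall z, box_edge a r z -> cmod (f z) <= M) ->
  box a (r / 2) w -> box a (r / 2) w' -> w \notin E -> w' \notin E ->
  cmod (f w - f w') <= 684 * M / r * cmod (w - w').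
Proof.
move=> r0 hf fM bw bw' wE w'E.
have [->|ww'] := eqVneq w w'; first by rewrite !subrr cmod0 mulr0.
have boxw' : box a r w'.
  move: bw' => [h1 h2]; split; move: h1 h2; rewrite !reimE; lra.
pose g z := (f z - f w') / (z - w').
have ndiff z : z != w' -> cdiff (fun z => (z - w')^-1) z.
  by move=> zw; apply: cdiffV; [rewrite subr_eq0|exact: cdiff_subid].
have dfw' : cdiff f w' by exact: (hf _ boxw').1.
have hg : almost_holomorphic g a r (w' :: E).
  move=> z bz; split.
    rewrite in_cons negb_or => /andP[zw' zE]; apply: cdiffM; last exact: ndiff.
    apply: cdiffB; [exact: (hf _ bz).1|exact: cdiff_cst].
  have [->|zw'] := eqVneq z w'; first exact: locally_bounded_quotient.
  apply: locally_boundedM; last exact/cdiff_locally_bounded/ndiff.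
  apply: locally_boundedB; first exact: (hf _ bz).2.
  exact/cdiff_locally_bounded/cdiff_cst.
have fw' := cauchy_estimate r0 hf fM bw' w'E.
have gM z : box_edge a r z -> cmod (g z) <= (19 * M) * (2 / r).
  move=> bz; have far := box_edge_far r0 bw' bz.
  have m0 : 0 < cmod (z - w') by apply: lt_le_trans far; rewrite divr_gt0.
  rewrite cmodM cmodV ler_pM ?cmod_ge0 ?invr_ge0 ?cmod_ge0//.
    by have := cmodD (f z) (- f w'); rewrite cmodN; have := fM _ bz; lra.
  by rewrite -[2 / r]invrK invf_div lef_pV2 ?posrE ?divr_gt0.
have := cauchy_estimate r0 hg gM bw; rewrite in_cons negb_or ww' => /(_ wE).
have m0 : 0 < cmod (w - w') by rewrite cmod_gt0 subr_eq0.
rewrite /g cmodM cmodV ler_pdivrMr// => h; apply: le_trans h _.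
by rewrite le_eqVlt; apply/orP; left; apply/eqP; field; rewrite gt_eqF.
Qed.

End cauchy.

(** * Behaviour at an isolated bounded singularity *)

Section germs.
Variable R : realType.
Local Notation C := (Cplx R).
Implicit Types (f g F : C -> C) (z w d a : C) (x y s t : R).

Lemma square_bounded f z0 s0 : 0 < s0 ->
  (forall a, square z0 s0 a -> locally_bounded f a) ->
  exists M, forall w, square z0 s0 w -> cmod (f w) <= M.
Proof.
move=> s00 h.
apply: (@square_induction R (fun z s => exists M, forall w, square z s w ->
  cmod (f w) <= M)) => //.
  move=> z s sp [M1 h1] [M2 h2] [M3 h3] [M4 h4];
    exists (`|M1| + `|M2| + `|M3| + `|M4|).
  move=> w /square_cover[/h1|/h2|/h3|/h4] {}h; apply: le_trans h _;
    have := normr_ge0 M1; have := normr_ge0 M2; have := normr_ge0 M3;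
      have := normr_ge0 M4;
    have := ler_norm M1; have := ler_norm M2; have := ler_norm M3;
      have := ler_norm M4; lra.
move=> a /h[M [r [r0 hM]]]; exists (r / 2); first by rewrite divr_gt0.
move=> z s /andP[sp sr] za; exists M => w zw; apply: hM.
by have := square_cmod zw za; lra.
Qed.

Lemma box_cmod a r z : box a r z -> cmod (z - a) <= 2 * r.
Proof.
move=> [h1 h2]; apply: le_trans (cmod_le _) _; move: h1 h2;
  rewrite !reimE => h1 h2.
have : `|re z - re a| <= r by rewrite ler_norml; lra.
have : `|im z - im a| <= r by rewrite ler_norml; lra.
lra.
Qed.

Lemma cmod_box a r z : cmod (z - a) <= r -> box a r z.
Proof.
move=> h; have := le_trans (re_cmod _) h; have := le_trans (im_cmod _) h.
rewrite !reimE !ler_norml => h1 h2; split; rewrite ?reimE; lra.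
Qed.

Definition bounded_singularity f a :=
  locally_bounded f a /\ \forall z \near a^', cdiff f z.

Lemma bounded_singularity_box f a : bounded_singularity f a -> exists r M : R,
  [/\ 0 < r, 0 <= M, almost_holomorphic f a r [:: a] &
      forall z, box_edge a r z -> cmod (f z) <= M].
Proof.
move=> [bf /dnbhs_cmodP[r r0 hr]]; have r40 : 0 < r / 4 by rewrite divr_gt0.
have ah : almost_holomorphic f a (r / 4) [:: a].
  move=> z bz; have zr : cmod (z - a) < r by have := box_cmod bz; lra.
  have [->|za] := eqVneq z a; first by rewrite mem_seq1 eqxx.
  by have dz := hr _ za zr; split=> // ; exact: cdiff_locally_bounded.
have r20 : 0 < 2 * (r / 4) by rewrite mulr_gt0.
have [M hM] := @square_bounded f (a - pt (r / 4) (r / 4)) _ r20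
  (fun z bz => (ah z bz).2).
exists (r / 4), `|M|; split => // z [bz _].
exact: le_trans (hM _ bz) (ler_norm _).
Qed.

(** Let [K] be a Lipschitz constant near [a]. If some value [f w] exceeds
    [2 * K * cmod (w - a)], then [f] cannot come down to 0 closer to [a] than
    [w]; if there is none, [f] is O(z - a). *)
Lemma small_or_away f a : bounded_singularity f a ->
  (exists K, \forall z \near a^', cmod (f z) <= K * cmod (z - a)) \/
  (exists2 c, 0 < c & \forall z \near a^', c <= cmod (f z)).
Proof.
move=> /bounded_singularity_box[r [M [r0 M0 hf fM]]].
set K := 684 * M / r; have K0 : 0 <= K.
  by apply: divr_ge0; [exact: mulr_ge0 (ler0n _ _) M0|exact: ltW].
have r20 : 0 < r / 2 by rewrite divr_gt0.
have lip z w : z != a -> w != a -> cmod (z - a) < r / 2 ->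
  cmod (w - a) < r / 2 ->
    cmod (f z - f w) <= K * cmod (z - w).
  move=> za wa zr wr; apply: cauchy_lipschitz hf fM _ _ _ _ => //;
    rewrite ?mem_seq1//;
  exact/cmod_box/ltW.
case: (pselect (exists w, [/\ w != a, cmod (w - a) < r / 2 &
  2 * K * cmod (w - a) < cmod (f w)])).
  move=> [w [wa wr hw]]; right; exists (cmod (f w) - 2 * K * cmod (w - a));
    first by rewrite subr_gt0.
  apply/dnbhs_cmodP; exists (cmod (w - a)); first by rewrite cmod_gt0 subr_eq0.
  move=> z za zw; have := lip _ _ wa za wr (lt_trans zw wr).
  have := cmodB_ge (f w) (f z).
  have : cmod (w - z) <= 2 * cmod (w - a).
    have -> : w - z = (w - a) - (z - a) by ring.
    by have := cmodD (w - a) (- (z - a)); rewrite cmodN; lra.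
  by move=> /(ler_wpM2l K0); lra.
move=> nw; left; exists (2 * K); apply/dnbhs_cmodP;
  exists (r / 2) => // z za zr.
by rewrite leNgt; apply/negP => h; apply: nw; exists z.
Qed.

Definition quo f a n z := f z / (z - a) ^+ n.

Lemma near_dnbhs_locally_bounded f a K :
  (\forall z \near a^', cmod (f z) <= K) -> locally_bounded f a.
Proof.
move=> /dnbhs_cmodP[r r0 h]; exists (`|K| + cmod (f a)), r; split=> // z zr.
have [->|za] := eqVneq z a; first by rewrite lerDr.
by apply: le_trans (h _ za zr) _;
  rewrite (le_trans (ler_norm _))// lerDl cmod_ge0.
Qed.

Lemma near_neq a : \forall z \near a^', z != a.
Proof. by apply/dnbhs_cmodP; exists 1. Qed.

Lemma cmod_quo f a n z K : z != a -> cmod (f z) <= K * cmod (z - a) ^+ n ->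
  cmod (quo f a n z) <= K.
Proof.
move=> za h; rewrite /quo cmodM cmodV cmodX ler_pdivrMr// exprn_gt0// cmod_gt0
  subr_eq0//.
Qed.

Lemma quo_cdiff f a n z : z != a -> cdiff f z -> cdiff (quo f a n) z.
Proof.
move=> za df; apply: cdiffM => //; apply: cdiffV; last exact/cdiffX/cdiff_subid.
by rewrite expf_neq0// subr_eq0.
Qed.

(** Schwarz's argument: by [cauchy_estimate] for [f z / (z - a) ^+ n], the value
    [f w] is at most [18 * M * (2 * cmod (w - a) / r) ^+ n], for every [n]. *)
Lemma flat_eq0 f a : bounded_singularity f a ->
  (forall n, exists K, \forall z \near a^',
    cmod (f z) <= K * cmod (z - a) ^+ n) ->
  \forall z \near a^', f z = 0.
Proof.
move=> /bounded_singularity_box[r [M [r0 M0 hf fM]]] flat.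
apply/dnbhs_cmodP; exists (r / 4); first by rewrite divr_gt0.
move=> w wa wr; have bw : box a (r / 2) w by apply: cmod_box; lra.
have est n : cmod (f w) <= 18 * M / 2 ^+ n.
  have hq : almost_holomorphic (quo f a n) a r [:: a].
    move=> z bz; rewrite mem_seq1; have [->|za] := eqVneq z a.
      split=> //; have [K hK] := flat n;
        apply: (@near_dnbhs_locally_bounded _ _ K).
      by apply: filterS2 hK (near_neq a) => z' h1 h2; exact: cmod_quo.
    have dz : cdiff f z by apply: (hf _ bz).1; rewrite mem_seq1.
    by have dq := quo_cdiff n za dz; split=> //; exact: cdiff_locally_bounded.
  have qM z : box_edge a r z -> cmod (quo f a n z) <= M * (2 / r) ^+ n.
    move=> bz; have ba : box a (r / 2) a by apply: cmod_box;
      rewrite subrr cmod0 divr_ge0// ltW.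
    have far := box_edge_far r0 ba bz.
    have m0 : 0 < cmod (z - a) by apply: lt_le_trans far; rewrite divr_gt0.
    rewrite cmodM cmodV cmodX ler_pM ?cmod_ge0 ?invr_ge0 ?exprn_ge0 ?cmod_ge0
      ?fM//.
    rewrite -exprVn lerXn2r ?nnegrE ?invr_ge0 ?cmod_ge0 ?divr_ge0 ?(ltW r0)//.
    by rewrite -[2 / r]invrK invf_div lef_pV2 ?posrE ?divr_gt0.
  have := cauchy_estimate r0 hq qM bw; rewrite mem_seq1 => /(_ wa).
  have m0 : 0 < cmod (w - a) by rewrite cmod_gt0 subr_eq0.
  rewrite /quo cmodM cmodV cmodX ler_pdivrMr ?exprn_gt0// => h;
    apply: le_trans h _.
  rewrite -!mulrA; apply: ler_wpM2l => //; apply: ler_wpM2l => //.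
  rewrite -exprMn -exprVn lerXn2r ?nnegrE ?invr_ge0 ?mulr_ge0 ?cmod_ge0
    ?invr_ge0 ?(ltW r0)//.
  rewrite mulrAC ler_pdivrMr//; lra.
apply/eqP; rewrite -cmod_eq0 eq_le cmod_ge0 andbT; apply/ler_addgt0Pr => e e0;
  rewrite add0r.
have [n _ hn] : \forall n \near \oo, (2^-1 : R) ^+ n < e / (18 * M + 1).
  have d0 : 0 < e / (18 * M + 1) by rewrite divr_gt0// ltr_wpDl// mulr_ge0.
  have /cvgrPdist_lt/(_ _ d0) : (2^-1 : R) ^+ n @[n --> \oo] --> (0 : R).
    by apply: cvg_expr; rewrite gtr0_norm ?invf_lt1 ?ltr1n.
  by apply: filterS => m; rewrite sub0r normrN ger0_norm ?exprn_ge0 ?invr_ge0.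
apply: le_trans (est n) _; rewrite -exprVn.
have := hn _ (leqnn n); rewrite /= ltr_pdivlMr ?ltr_wpDl ?mulr_ge0//.
have : 0 <= (2^-1 : R) ^+ n by rewrite exprn_ge0 ?invr_ge0.
set u := _ ^+ n; lra.
Qed.

(** [F] has order [n] at [a]: a zero of order [n], or a pole of order [- n].
    Comparing moduli spares the removable singularity theorem. *)
Definition growth F a (n : int) := exists c K, 0 < c /\
  \forall z \near a^', c * cmod (z - a) ^ n <= cmod (F z) <=
    K * cmod (z - a) ^ n.

(** Take the last [m] such that [f] is O((z - a) ^+ m); [flat_eq0] gives its
    existence, and [small_or_away] for the quotient the lower bound. *)
Lemma bounded_singularity_growth f a : bounded_singularity f a ->
  (\forall z \near a^', f z = 0) \/ exists n : nat, growth f a n.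
Proof.
move=> pf; pose Bd n := exists K, \forall z \near a^',
  cmod (f z) <= K * cmod (z - a) ^+ n.
have [all_n|] := pselect (forall n, Bd n); first by left; exact: flat_eq0.
move=> /existsNP[n0 nB]; right.
have Bd0 : Bd 0%N.
  have [[M [r [r0 h]]] _] := pf; exists M; apply/dnbhs_cmodP;
    exists r => // z _ /h.
  by rewrite mulr1.
have [m Bm nBm] : exists2 m, Bd m & ~ Bd m.+1.
  apply: contrapT => h; apply: nB; elim: n0 => // n IH.
  by apply: contrapT => nBn; apply: h; exists n.
exists m; have [K hK] := Bm.
have pq : bounded_singularity (quo f a m) a.
  split; first apply: (@near_dnbhs_locally_bounded _ _ K).
    by apply: filterS2 hK (near_neq a) => z h1 h2; exact: cmod_quo.
  apply: filterS2 pf.2 (near_neq a) => z df za; exact: quo_cdiff.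
have [[K' hK']|[c c0 hc]] := small_or_away pq.
  exfalso; apply: nBm; exists K'; apply: filterS2 hK' (near_neq a) => z.
  move=> + za; have m0 : 0 < cmod (z - a) by rewrite cmod_gt0 subr_eq0.
  rewrite /quo cmodM cmodV cmodX ler_pdivrMr ?exprn_gt0// => h;
    apply: le_trans h _.
  by rewrite exprS mulrA.
exists c, K; split=> //; apply: filterS3 hc hK (near_neq a) => z h1 h2 za.
have m0 : 0 < cmod (z - a) by rewrite cmod_gt0 subr_eq0.
rewrite -exprnP h2 andbT; move: h1; rewrite /quo cmodM cmodV cmodX.
by rewrite ler_pdivlMr ?exprn_gt0.
Qed.

End germs.

(** * Growth exponents, the identity theorem and inverses *)

Section order.
Variable R : realType.
Local Notation C := (Cplx R).
Implicit Types (f g h F G : C -> C) (z w d a : C) (x y s t : R).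

Lemma dnbhs_dnbhs (P : C -> Prop) a : (\forall z \near a^', P z) ->
  \forall w \near a, \forall z \near w^', P z.
Proof.
move=> /dnbhs_cmodP[r r0 h]; apply/nbhs_cmodP; exists r => // w wr.
have [->|wa] := eqVneq w a; first by apply/dnbhs_cmodP; exists r.
have m0 : 0 < cmod (w - a) by rewrite cmod_gt0 subr_eq0.
apply/dnbhs_cmodP; exists (Num.min (r - cmod (w - a)) (cmod (w - a))).
  by rewrite lt_min subr_gt0 wr.
move=> z _; rewrite lt_min => /andP[z1 z2]; apply: h.
  by apply: contraTneq z2 => ->; rewrite cmodB ltxx.
have -> : z - a = (z - w) + (w - a) by ring.
by have := cmodD (z - w) (w - a); lra.
Qed.

Lemma near_cmod_gt0 a : \forall z \near a^', 0 < cmod (z - a).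
Proof. by apply: filterS (near_neq a) => z; rewrite cmod_gt0 subr_eq0. Qed.

Lemma growth_near F G a n : (\forall z \near a^', F z = G z) ->
  growth F a n -> growth G a n.
Proof.
move=> FG [c [K [c0 h]]]; exists c, K; split=> //.
by apply: filterS2 FG h => z ->.
Qed.

Lemma growthM F G a n m : growth F a n -> growth G a m ->
  growth (fun z => F z * G z) a (n + m).
Proof.
move=> [c [K [c0 h]]] [c' [K' [c'0 h']]]; exists (c * c'), (K * K'); split;
  first exact: mulr_gt0.
apply: filterS3 h h' (near_cmod_gt0 a) => z /andP[h1 h2] /andP[h3 h4] m0.
rewrite cmodM expfzDr ?gt_eqF// !(mulrACA _ _ (_ ^ n)).
have p0 (k : int) : 0 < cmod (z - a) ^ k by rewrite exprz_gt0.
by rewrite !ler_pM ?cmod_ge0// mulr_ge0// ltW.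
Qed.

Lemma growth_unique_le F a (n m : int) : growth F a n -> growth F a m ->
  (m <= n)%R.
Proof.
move=> [c [K [c0 h]]] [c' [K' [c'0 h']]]; rewrite leNgt; apply/negP => nm.
have : \forall z \near a^', c <= `|K'| * cmod (z - a).
  have near1 : \forall z \near a^', cmod (z - a) < 1 by apply/dnbhs_cmodP;
    exists 1.
  apply: filterS3 (filterI h h') near1 (near_cmod_gt0 a) =>
    z [/andP[h1 _] /andP[_ h2]] z1 z0.
  have p0 : 0 < cmod (z - a) ^ n by rewrite exprz_gt0.
  have := le_trans h1 h2; have -> : m = n + (m - n) by ring.
  rewrite expfzDr ?gt_eqF// mulrCA [_ * (K' * _)]mulrC ler_pM2r// =>
    /le_trans; apply.
  apply: (@le_trans _ _ (`|K'| * cmod (z - a) ^ (m - n))).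
    by rewrite ler_wpM2r ?ler_norm// ltW// exprz_gt0.
  apply: ler_wpM2l => //; have : (1 <= m - n) by lia.
  case: (m - n) => // -[//|k] _; rewrite -exprnP exprS ler_piMr ?(ltW z0)//.
  by rewrite exprn_ile1 ?ltW.
move=> /dnbhs_cmodP[r r0 hr].
have K0 : 0 < `|K'| + 1 by rewrite ltr_wpDl.
pose t := Num.min (r / 2) (c / (`|K'| + 1) / 2).
have t0 : 0 < t by rewrite lt_min !divr_gt0.
have tr : t <= r / 2 by rewrite ge_min lexx.
have tc : t <= c / (`|K'| + 1) / 2 by rewrite ge_min lexx orbT.
have mt : cmod (a + pt t 0 - a) = t.
  rewrite addrAC subrr add0r cmod_def /re /im /= expr0n /= addr0 sqrtr_sqr
    gtr0_norm//.
have := hr (a + pt t 0); rewrite mt => H.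
have : c <= `|K'| * t.
  by apply: H; [rewrite -subr_eq0 -cmod_eq0 mt gt_eqF|lra].
have : (`|K'| + 1) * t <= c / 2.
  by rewrite mulrC -ler_pdivlMr// mulrAC.
lra.
Qed.

Lemma growth_unique F a (n m : int) : growth F a n -> growth F a m -> n = m.
Proof.
by move=> hn hm; apply/eqP; rewrite eq_le !(growth_unique_le (F := F) (a := a)).
Qed.

Lemma growth0 F a : cdiff F a -> F a != 0 -> growth F a 0.
Proof.
move=> [d hd] Fa; have m0 : 0 < cmod (F a) by rewrite cmod_gt0.
have [r r0 hr] := hd 1 ltr01; have d1 : 0 < 1 + cmod d by have := cmod_ge0 d;
  lra.
exists (cmod (F a) / 2), (cmod (F a) * 2); split; first by rewrite divr_gt0.
apply/dnbhs_cmodP; exists (Num.min r (cmod (F a) / 2 / (1 + cmod d))).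
  by rewrite lt_min r0 !divr_gt0.
move=> z za; rewrite lt_min => /andP[zr zs]; rewrite expr0z !mulr1.
have l : cmod (F z - F a) <= cmod (F a) / 2.
  have -> : F z - F a = (F z - F a - d * (z - a)) + d * (z - a) by ring.
  apply: le_trans (cmodD _ _) _; have := hr z zr; rewrite (cmodM d).
  by move: zs; rewrite ltr_pdivlMr//; lra.
have := cmodB_ge (F a) (F z); rewrite cmodB.
have := cmodD (F z - F a) (F a); rewrite subrK; lra.
Qed.

Lemma growth_XnzB a (n : int) : growth (fun z => (z - a) ^ n) a n.
Proof.
exists 1, 1; split=> //; apply: filterE => z.
by rewrite cmodXz mul1r lexx.
Qed.

Lemma growth_neq0 F a n : growth F a n -> \forall z \near a^', F z != 0.
Proof.
move=> [c [K [c0 h]]]; apply: filterS2 h (near_cmod_gt0 a) => z /andP[h _] m0.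
by rewrite -cmod_gt0; apply: lt_le_trans h; rewrite mulr_gt0// exprz_gt0.
Qed.

Lemma holomorphic_at_bounded_singularity g a : holomorphic_at g a ->
  bounded_singularity g a.
Proof.
move=> hg; split; first exact/cdiff_locally_bounded/cdiffP/(nbhs_singleton hg).
by apply: filterS (nbhs_dnbhs hg) => z /cdiffP.
Qed.

Lemma meromorphic_growth F a : meromorphic F ->
  (\forall z \near a^', F z = 0) \/ exists n, growth F a n.
Proof.
move=> /(_ a)[n [g hg Fg]].
have [g0|[m gm]] := bounded_singularity_growth
  (holomorphic_at_bounded_singularity hg).
  by left; apply: filterS2 Fg g0 => z -> ->; rewrite mulr0.
right; exists (- n%:Z + m);
  apply: growth_near (growthM (growth_XnzB a (- n%:Z)) gm).
by apply: filterS Fg => z ->; rewrite -exprnN.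
Qed.

(** Zeros and poles are isolated. *)
Lemma growth_near0 F a n : meromorphic F -> growth F a n ->
  \forall z \near a^', growth F z 0.
Proof.
move=> /(_ a)[m [g /holomorphic_at_bounded_singularity[_ hg] Fg]]
  /growth_neq0 F0.
have := nbhs_dnbhs (dnbhs_dnbhs Fg).
apply: filterS3 (filterI Fg F0) (filterI hg (near_neq a)) =>
  z [Fz Fz0] [dg za] Fgz.
have za0 : z - a != 0 by rewrite subr_eq0.
apply: (@growth_near (fun z => (z - a) ^- m * g z)).
  by apply: filterS Fgz => w ->.
apply: growth0; last by rewrite -Fz.
apply: cdiffM => //; apply: cdiffV; first by rewrite expf_neq0.
exact/cdiffX/cdiff_subid.
Qed.

(** Near each point [F] vanishes throughout a punctured neighbourhood or nowhere
    in one; [square_induction] extends the alternative to a square around both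
    points, because neighbouring quarters share the centre. *)
Lemma identity_theorem F a b : meromorphic F ->
  (\forall z \near a^', F z = 0) ->
  \forall z \near b^', F z = 0.
Proof.
move=> mF Za; pose Z w := \forall z \near w^', F z = 0.
pose s := `|re b - re a| + `|im b - im a| + 1.
have s0 : 0 < s by rewrite ltr_wpDl.
have [] : (forall w, square (a - pt s s) (2 * s) w -> Z w) \/
    (forall w, square (a - pt s s) (2 * s) w -> ~ Z w); last 2 first.
- apply; split; rewrite !reimE.
    have := ler_norm (re b - re a); have := ler_norm (- (re b - re a));
      rewrite normrN.
    have := normr_ge0 (im b - im a); rewrite /s; lra.
  have := ler_norm (im b - im a); have := ler_norm (- (im b - im a));
    rewrite normrN.
  have := normr_ge0 (re b - re a); rewrite /s; lra.
- by move=> /(_ a) nZ; exfalso; apply: nZ => //; split; rewrite !reimE; lra.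
apply: (@square_induction R (fun z s => (forall w, square z s w -> Z w) \/
    (forall w, square z s w -> ~ Z w))); first by rewrite mulr_gt0.
  move=> z t t0 h1 h2 h3 h4; pose c := z + pt (t / 2) (t / 2).
  have c1 : square z (t / 2) c by split; rewrite !reimE; lra.
  have c2 : square (z + pt (t / 2) 0) (t / 2) c by split; rewrite !reimE; lra.
  have c3 : square (z + pt 0 (t / 2)) (t / 2) c by split; rewrite !reimE; lra.
  have c4 : square (z + pt (t / 2) (t / 2)) (t / 2) c by split;
    rewrite !reimE; lra.
  have [Zc|nZc] := pselect (Z c); [left|right] => w /square_cover[] ww.
  - by case: h1 => h; [exact: (h w ww)|case: (h c c1 Zc)].
  - by case: h2 => h; [exact: (h w ww)|case: (h c c2 Zc)].
  - by case: h3 => h; [exact: (h w ww)|case: (h c c3 Zc)].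
  - by case: h4 => h; [exact: (h w ww)|case: (h c c4 Zc)].
  - by case: h1 => h; [case: (nZc (h c c1))|exact: (h w ww)].
  - by case: h2 => h; [case: (nZc (h c c2))|exact: (h w ww)].
  - by case: h3 => h; [case: (nZc (h c c3))|exact: (h w ww)].
  - by case: h4 => h; [case: (nZc (h c c4))|exact: (h w ww)].
have near_square c (Q : C -> Prop) : (\forall w \near c, Q w) ->
  exists2 r, 0 < r &
    forall z s, 0 < s < r -> square z s c -> forall w, square z s w -> Q w.
  move=> /nbhs_cmodP[r r0 h]; exists (r / 2); first by rewrite divr_gt0.
  move=> z t /andP[t0 tr] zc w zw; apply: h; have := square_cmod zw zc; lra.
move=> c _; have [Zc|[n gc]] := meromorphic_growth c mF.
  have [r r0 h] := near_square _ _ (dnbhs_dnbhs Zc).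
  by exists r => // z t tr zc; left; exact: h tr zc.
have [r r0 h] := near_square _ _ (dnbhs_dnbhs (growth_neq0 gc)).
exists r => // z t tr zc; right => w zw Zw.
have [u [/eqP Fu Fu0]] := filter_ex (filterI (h z t tr zc w zw) Zw);
  exact: Fu Fu0.
Qed.

Lemma closed_discrete_square (A : set C) z0 s0 : 0 < s0 -> closed_discrete A ->
  finite_set (square z0 s0 `&` A).
Proof.
move=> s00 /closed_discreteP dA.
apply: (@square_induction R (fun z s => finite_set (square z s `&` A))) => //.
  move=> z s _ h1 h2 h3 h4.
  apply: (@sub_finite_set _ _ ((square z (s / 2) `&` A) `|`
    (square (z + pt (s / 2) 0) (s / 2) `&` A) `|`
    (square (z + pt 0 (s / 2)) (s / 2) `&` A) `|`
    (square (z + pt (s / 2) (s / 2)) (s / 2) `&` A))).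
    by move=> w [/square_cover[] ? ?];
      [left; left; left|left; left; right|left; right|right].
  by rewrite !finite_setU.
move=> a _; have /dnbhs_cmodP[r r0 h] := dA a; exists (r / 2);
  first by rewrite divr_gt0.
move=> z s /andP[sp sr] za;
  apply: (@sub_finite_set _ _ [set a]) => // w [zw Aw] /=.
apply: contrapT => /eqP wa; apply: h wa _ Aw.
by have := square_cmod zw za; lra.
Qed.

(** Writing [F z = (z - a) ^- m * g z] with [g] of order [p] at [a], the factor
    [(z - a) ^+ (p + 2 + m)] not only compensates the zero of [g] but leaves at
    least two spare powers, so that the numerator has derivative 0 at [a]; no
    singularity has to be removed. *)
Lemma meromorphicV F : meromorphic F -> (forall a, exists n, growth F a n) ->
  meromorphic (fun z => (F z)^-1).
Proof.
move=> mF gF a; have [m [g hg Fg]] := mF a; have [n gn] := gF a.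
have pg := holomorphic_at_bounded_singularity hg.
have [g0|[p [c [K [c0 hp]]]]] := bounded_singularity_growth pg.
  exfalso; have [z [/eqP + [zF]]] :=
    filter_ex (filterI (growth_neq0 gn) (filterI Fg g0)).
  by move=> + z0; rewrite zF z0 mulr0.
exists (p + 2)%N, (fun z => (z - a) ^+ (p + 2 + m) / g z); last first.
  apply: filterS2 Fg (near_neq a) => z -> za.
  have za0 : (z - a) != 0 by rewrite subr_eq0.
  rewrite invfM invrK (exprD _ (p + 2) m) -[_ * _ / g z]mulrA.
  by rewrite mulKf// expf_neq0.
have dh : \forall z \near a^', cdiff (fun z => (z - a) ^+ (p + 2 + m) / g z) z.
  have g0 : growth g a p by exists c, K.
  apply: filterS2 pg.2 (growth_neq0 g0) => z dg gz.
  by apply: cdiffM; [exact/cdiffX/cdiff_subid|exact: cdiffV].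
have da : cdiff (fun z => (z - a) ^+ (p + 2 + m) / g z) a.
  exists 0 => e e0; have /dnbhs_cmodP[r r0 hr] := hp.
  exists (Num.min r (Num.min 1 (e * c)));
    first by rewrite !lt_min r0 ltr01 mulr_gt0.
  move=> z; rewrite !lt_min => /and3P[zr z1 zc].
  have -> : (a - a) ^+ (p + 2 + m) / g a = 0
    by rewrite subrr expr0n addn2 mul0r.
  rewrite !(mul0r, subr0).
  have [->|za] := eqVneq z a;
    first by rewrite subrr expr0n addn2 mul0r cmod0 mulr0.
  have m0 : 0 < cmod (z - a) by rewrite cmod_gt0 subr_eq0.
  have /andP[h _] := hr _ za zr; rewrite -exprnP in h.
  have mp := exprn_gt0 p m0.
  have mg : 0 < cmod (g z) by apply: lt_le_trans h; rewrite mulr_gt0.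
  rewrite cmodM cmodV cmodX ler_pdivrMr//;
    set t := cmod (z - a) in m0 z1 zc h mp *.
  have t2m : t ^+ (p.+2 + m) <= t * (t * t ^+ p).
    rewrite exprD -!exprS; apply: ler_piMr; first exact/exprn_ge0/ltW.
    by apply: exprn_ile1; exact: ltW.
  rewrite addn2.
  apply: le_trans t2m _; rewrite [e * t]mulrC -mulrA; apply: ler_wpM2l;
    first exact: ltW.
  apply: (@le_trans _ _ (e * (c * t ^+ p))); last by rewrite ler_wpM2l// ltW.
  by rewrite mulrA ler_wpM2r// ltW.
have /dnbhs_cmodP[r r0 h] := dh.
apply/nbhs_cmodP; exists r => // z zr; apply/cdiffP.
by have [->//|za] := eqVneq z a; exact: h.
Qed.

End order.

(** * Orders and the multiplicative group of meromorphic functions *)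

Local Open Scope quotient_scope.

Section mero.
Variable R : realType.
Local Notation C := (Cplx R).
Implicit Types (F G : C -> C) (z w d a : C) (x y s t : R) (f g : mero R).

(** For a meromorphic [F], the default value 0 is used only if [F] vanishes
    near [a]. *)
Definition order F a : int := xget 0 [set n | growth F a n].

Lemma orderE F a n : growth F a n -> order F a = n.
Proof.
move=> h; apply: (growth_unique (F := F) (a := a) _ h).
exact: (@xgetPex _ 0 [set n | growth F a n] (ex_intro _ n h)).
Qed.

Lemma orderP F a : (exists n, growth F a n) -> growth F a (order F a).
Proof. by move=> [n h]; rewrite (orderE h). Qed.

Definition rep f : C -> C := mero_fun_val (repr f).

Lemma rep_mero f : meromorphic (rep f).
Proof. by rewrite /rep; case: (repr f) => F /= /asboolP. Qed.

(** A set is closed and discrete when it avoids a punctured neighbourhood of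
    every point, so classes of meromorphic functions are families of germs. *)
Lemma eq_piP (u v : mero_fun R) : u = v %[mod mero R] <->
  forall a, \forall z \near a^', u z = v z.
Proof.
split=> [/eqP|h]; last apply/eqP.
  rewrite -Quotient.idealrBE => /asboolP/closed_discreteP h a.
  by apply: filterS (h a) => z /negP; rewrite negbK => /eqP e;
    apply: subr0_eq; exact: e.
rewrite -Quotient.idealrBE; apply/asboolP/closed_discreteP => a.
apply: filterS (h a) => z uv; apply/negP; rewrite negbK; apply/eqP.
by rewrite [LHS](_ : _ = u z - v z)// uv subrr.
Qed.

Lemma rep_pi (u : mero_fun R) a : \forall z \near a^',
  rep (\pi_(mero R) u) z = u z.
Proof.
by move: a; apply/(eq_piP (repr (\pi_(mero R) u))); rewrite reprK.
Qed.

Lemma repM f g a : \forall z \near a^', rep (f * g) z = rep f z * rep g z.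
Proof.
have -> : f * g = \pi_(mero R) (repr f * repr g) by rewrite rmorphM /= !reprK.
exact: rep_pi.
Qed.

Lemma eq_repP f g : f = g <-> forall a, \forall z \near a^', rep f z = rep g z.
Proof. by rewrite -eq_piP !reprK. Qed.

(** By [identity_theorem], only the zero class vanishes near some point. *)
Lemma neq0_growth f : f != 0 -> forall a, exists n, growth (rep f) a n.
Proof.
move=> f0 a; have [Za|//] := meromorphic_growth a (@rep_mero f); exfalso.
move/eqP: f0; apply; apply/eq_repP => b.
have Zb := identity_theorem b (@rep_mero f) Za.
have r0 : \forall z \near b^', rep (0 : mero R) z = 0.
  have -> : (0 : mero R) = \pi_(mero R) 0 by rewrite rmorph0.
  exact: rep_pi.
by apply: filterS2 Zb r0 => z -> ->.
Qed.

Lemma growth_neq0_mero f a n : growth (rep f) a n -> f != 0.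
Proof.
move=> gf; apply/eqP => f0; move: gf; rewrite f0 => /growth_neq0 h.
have r0 : \forall z \near a^', rep (0 : mero R) z = 0.
  have -> : (0 : mero R) = \pi_(mero R) 0 by rewrite rmorph0.
  exact: rep_pi.
by have [z [/eqP]] := filter_ex (filterI h r0).
Qed.

Lemma mero_mulf_neq0 f g : f != 0 -> g != 0 -> f * g != 0.
Proof.
move=> /neq0_growth/(_ 0)[n hf] /neq0_growth/(_ 0)[m hg].
apply: (@growth_neq0_mero _ 0 (n + m)); apply: growth_near (growthM hf hg).
by apply: filterS (repM f g 0) => z ->.
Qed.

Lemma mero_inv f : f != 0 -> exists g, g * f = 1.
Proof.
move=> f0; have gf := neq0_growth f0.
have mV : (fun z => (rep f z)^-1) \in @meromorphic_pred R.
  by apply/asboolP; exact: meromorphicV (@rep_mero f) gf.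
exists (\pi_(mero R) (MeroFun mV)); apply/eq_repP => a.
have r1 : \forall z \near a^', rep (1 : mero R) z = 1.
  have -> : (1 : mero R) = \pi_(mero R) 1 by rewrite rmorph1.
  exact: rep_pi.
have [n /growth_neq0 h] := gf a.
apply: filterS3 (filterI r1 h) (repM (\pi_(mero R) (MeroFun mV)) f a)
  (rep_pi (MeroFun mV) a).
by move=> z [-> fz] -> -> /=; rewrite mulVf.
Qed.

Lemma mero_nz_mulE (f g : mero_nz R) : val (mero_nz_mul f g) = val f * val g.
Proof. by rewrite /mero_nz_mul insubdK//;
  exact: mero_mulf_neq0 (valP f) (valP g). Qed.

Lemma order_support F : meromorphic F -> (forall a, exists n, growth F a n) ->
  closed_discrete [set a | order F a != 0].
Proof.
move=> mF gF; apply/closed_discreteP => a; have [n gn] := gF a.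
apply: filterS (growth_near0 mF gn) => z /orderE oz; apply/negP.
by rewrite negbK; apply/eqP.
Qed.

End mero.

(** * Restriction to the unit square *)

Section unit_square.
Variable R : realType.
Local Notation C := (Cplx R).

(** Taking the square instead of a disc allows [square_induction] to prove
    finiteness of the support. *)
Definition unit_square_part (u : C -> int) (a : C) : int :=
  if `[< square 0 1 a >] then u a else 0.

Lemma unit_square_part_finite u : closed_discrete [set a | u a != 0] ->
  finite_set [set a | unit_square_part u a != 0].
Proof.
move=> /(@closed_discrete_square R _ 0 1 ltr01); apply: sub_finite_set => a /=.
by rewrite /unit_square_part; case: asboolP; rewrite ?eqxx.
Qed.

Lemma unit_interval_uncountable : ~ countable `[0 : R, 1]%classic.
Proof.
move=> /countable_lebesgue_measure0;
  rewrite lebesgue_measure_itv /= lte_fin ltr01.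
by rewrite oppr0 addr0 => /eqP; rewrite onee_eq0.
Qed.

(** The divisors of the points of the unit interval are pairwise distinct, and
    the interval has positive Lebesgue measure. *)
Lemma uncountable_range (G : Type) (phi : G -> C -> int) (point : R -> G) :
  (forall t b,
    phi (point t) b = unit_square_part (fun a => (a == pt t 0)%:R) b) ->
  ~ countable (range phi).
Proof.
move=> hd c; apply: unit_interval_uncountable; apply: sub_countable c.
apply: (@card_le_trans _ _ _ ((phi \o point) @` `[0 : R, 1]%classic)).
  suff /inj_card_eq : {in `[0 : R, 1]%classic &, injective (phi \o point)}.
    by rewrite card_eq_le => /andP[].
  move=> t t'; rewrite !inE /= => t01 t'01 /(congr1 (fun u => u (pt t 0))) /=.
  rewrite !hd /unit_square_part asboolT; last by split;
    rewrite ?addr0 ?add0r //= lexx ler01.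
  by rewrite eqxx; case: eqP => // -[].
by apply: subset_card_le => _ [t _ <-]; exists (point t).
Qed.

End unit_square.

Theorem corollaryB8 (R : realType) :
  ~ has_polish_semigroup_topology R (fun d1 d2 : divisor R => d1 + d2) /\
  ~ has_polish_semigroup_topology R (@mero_nz_mul R).
Proof.
split=> -[tau [pT cT]].
  pose phi (d : divisor R) := unit_square_part d.
  have dP t : (fun a : Cplx R => (a == pt t 0)%:R : int) \in @divisor_pred R.
    apply/asboolP/closed_discreteP => a; apply/dnbhs_cmodP.
    have [->|ta] := eqVneq a (pt t 0);
      first by exists 1 => // z /negbTE zt _ /=; rewrite zt.
    exists (cmod (pt t 0 - a)); first by rewrite cmod_gt0 subr_eq0 eq_sym.
    move=> z _ zr; apply/negP; rewrite negbK; apply/eqP => /=.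
    by case: eqP zr => // ->; rewrite ltxx.
  apply: (@uncountable_range R _ phi (fun t => Divisor (dP t))); first by [].
  apply: (@hom_free_abelian_countable R (Topological.Pack tau)
    (fun d1 d2 : divisor R => d1 + d2)
    (0 : divisor R) (fun d : divisor R => - d) _ phi _ _ _ cT _ _ pT).
  - exact: add0r.
  - exact: addr0.
  - exact: addNr.
  - by move=> x y i; rewrite /phi /unit_square_part; case: asboolP;
    rewrite ?addr0.
  - by move=> [d dd]; apply: unit_square_part_finite; exact/asboolP.
pose phi (f : mero_nz R) := unit_square_part (order (rep (val f))).
have gf (f : mero_nz R) a : exists n, growth (rep (val f)) a n.
  exact: neq0_growth (valP f) a.
have mt t : (fun z : Cplx R => z - pt t 0) \in @meromorphic_pred R.
  apply/asboolP => a; exists 0%N, (fun z => z - pt t 0).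
    by apply: (@filterE _ (nbhs a)) => z; apply/cdiffP/cdiff_subid.
  by apply: (@filterE _ (a^')) => z; rewrite expr0 invr1 mul1r.
pose et t : mero R := \pi_(mero R) (MeroFun (mt t)).
have et_growth t b : growth (rep (et t)) b (b == pt t 0)%:R.
  apply: (@growth_near _ (fun z => z - pt t 0)).
    by apply: filterS (rep_pi (MeroFun (mt t)) b) => z ->.
  have [->|bt] := eqVneq b (pt t 0); first exact: (growth_XnzB (pt t 0) 1).
  by apply: growth0; [exact: cdiff_subid|rewrite subr_eq0].
have et0 t : et t != 0 := growth_neq0_mero (et_growth t 0).
have inv_ex (f : mero_nz R) : exists g : mero_nz R,
  mero_nz_mul g f = mero_nz1 R.
  have [g gf1] := mero_inv (valP f).
  have g0 : g != 0.
    by apply/eqP => g0; move: gf1; rewrite g0 mul0r => /esym/eqP;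
      rewrite oner_eq0.
  by exists (exist _ g g0); apply/val_inj; rewrite mero_nz_mulE.
have [inv invP] := choice inv_ex.
apply: (@uncountable_range R _ phi (fun t => exist _ (et t) (et0 t))).
  move=> t b; rewrite /phi /unit_square_part /=; case: asboolP => // _;
    exact: orderE.
apply: (@hom_free_abelian_countable R (Topological.Pack tau) (@mero_nz_mul R)
  (mero_nz1 R) inv _ phi _ _ _ cT _ _ pT).
- by move=> f; apply/val_inj; rewrite /= mero_nz_mulE mul1r.
- by move=> f; apply/val_inj; rewrite /= mero_nz_mulE mulr1.
- exact: invP.
- move=> f g i; rewrite /phi /unit_square_part; case: asboolP => // _;
  apply: orderE.
  rewrite mero_nz_mulE; apply: growth_near (growthM (orderP (gf f i))
    (orderP (gf g i))).
  by apply: filterS (repM (val f) (val g) i) => z ->.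
- by move=> f; apply: unit_square_part_finite; apply: order_support => //;
  exact: rep_mero.
Qed.
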